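(* The following hold. (1) The big-O problem is undecidable, even when the input weighted automaton is a labelled Markov chain. (2) Each of the four threshold problems (asymmetric non-strict, asymmetric strict, symmetric non-strict, symmetric strict) is undecidable, even under the promise of boundedness. (3) Each of the four approximation tasks (asymmetric additive, asymmetric multiplicative, symmetric additive, symmetric multiplicative) is recursively unsolvable (no algorithm computes a correct output for all inputs), even under the promise of boundedness.
   Context: A (non-negative) weighted automaton is a tuple $\langle Q,\Sigma,M,F\rangle$ with $Q$ a finite set of states, $\Sigma$ a finite alphabet, $M:\Sigma\to\mathbb{Q}_{\ge 0}^{Q\times Q}$ and $F\subseteq Q$ a set of final states; weights are given in binary as numerator/denominator pairs. For $s\in Q$ and $w=a_1\cdots a_n\in\Sigma^*$, the weight of $w$ from $s$ is $\nu_s(w)=\sum_{t\in F}(M(a_1)\cdots M(a_n))_{s,t}$. For states $s,s'$, $s$ is big-O of $s'$ if there is $C>0$ with $\nu_s(w)\le C\,\nu_{s'}(w)$ for all $w\in\Sigma^*$. The big-O problem: given a weighted automaton and states $s,s'$, decide whether $s$ is big-O of $s'$. A labelled Markov chain (LMC) is a weighted automaton such that for every $q\in Q\setminus F$, $\sum_{q'\in Q}\sum_{a\in\Sigma}M(a)(q,q')=1$, and $M(a)(q,q')=0$ for all $a$, all $q\in F$, $q'\in Q$. For an LMC and $E\subseteq\Sigma^*$ put $\nu_s(E)=\sum_{w\in E}\nu_s(w)$. Define $\mathrm{tv}_\times(s,s')=\sup_{E\subseteq\Sigma^*}\nu_s(E)/\nu_{s'}(E)$ with conventions $0/0=0$ and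 $x/0=\infty$ for $x>0$, and $\mathrm{tv}_{\times}^{\mathrm{sym}}(s,s')=\max\{\mathrm{tv}_\times(s,s'),\mathrm{tv}_\times(s',s)\}$. Asymmetric threshold problem: given an LMC, states $s,s'$ and a rational $\theta$, decide whether $\mathrm{tv}_\times(s,s')\le\theta$; the strict variant asks whether $\mathrm{tv}_\times(s,s')<\theta$. The promise of boundedness restricts inputs to those with $\mathrm{tv}_\times(s,s')<\infty$ (a promise problem: on inputs violating the promise, any behaviour is allowed). Asymmetric additive approximation task: given an LMC, $s,s'$ and $\gamma>0$, output $x$ with $|\mathrm{tv}_\times(s,s')-x|\le\gamma$. Asymmetric multiplicative approximation task: output $x$ with $1-\gamma\le x/\mathrm{tv}_\times(s,s')\le1+\gamma$. Symmetric variants replace $\mathrm{tv}_\times$ by $\mathrm{tv}_{\times}^{\mathrm{sym}}$ throughout (including in the promise). *)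

(* Defs.v *)
From HB Require Import structures.
From mathcomp Require Import all_boot all_order all_algebra.
From mathcomp Require Import all_classical all_reals.
From mathcomp Require Import ereal esum.

Set Implicit Arguments.
Unset Strict Implicit.
Unset Printing Implicit Defensive.

Import Order.TTheory GRing.Theory Num.Theory.

(* 1. A model of computation: partial recursive functions nat -> nat,  *)
(*    with tuples coded by the Cantor pairing function.                *)

Definition cpair (x y : nat) : nat := ((x + y) * (x + y).+1) %/ 2 + y.

Inductive code : Type :=
| cZero
| cSucc
| cFst
| cSnd
| cPair of code & code
| cComp of code & code
| cRec  of code & code
| cMu   of code.

Inductive eval : code -> nat -> nat -> Prop :=
| evZero x : eval cZero x 0
| evSucc x : eval cSucc x x.+1
| evFst x y : eval cFst (cpair x y) x
| evSnd x y : eval cSnd (cpair x y) y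
| evPair f g x a b : eval f x a -> eval g x b -> eval (cPair f g) x (cpair a b)
| evComp f g x y z : eval g x y -> eval f y z -> eval (cComp f g) x z
| evRec0 f g x a : eval f x a -> eval (cRec f g) (cpair x 0) a
| evRecS f g x n a b : eval (cRec f g) (cpair x n) a ->
    eval g (cpair x (cpair n a)) b -> eval (cRec f g) (cpair x n.+1) b
| evMu f x n : eval f (cpair x n) 0 ->
    (forall m, m < n -> exists v, eval f (cpair x m) v.+1) ->
    eval (cMu f) x n.

Definition decides {T : Type} (enc : T -> nat) (Pr P : T -> Prop) (c : code) :=
  forall x, Pr x -> (P x -> eval c (enc x) 1) /\ (~ P x -> eval c (enc x) 0).

Definition undecidable {T : Type} (enc : T -> nat) (Pr P : T -> Prop) :=
  ~ exists c, decides enc Pr P c.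

Definition enc_int (z : int) : nat :=
  match z with Posz n => n.*2 | Negz n => n.*2.+1 end.

Definition enc_rat (q : rat) : nat := cpair (enc_int (numq q)) (enc_int (denq q)).

Fixpoint enc_list {A : Type} (f : A -> nat) (l : seq A) : nat :=
  if l is x :: l' then (cpair (f x) (enc_list f l')).+1 else 0.

Definition solves {T : Type} (enc : T -> nat) (Pr : T -> Prop)
    (Good : T -> rat -> Prop) (c : code) :=
  forall x, Pr x -> exists q, eval c (enc x) (enc_rat q) /\ Good x q.

Definition unsolvable {T : Type} (enc : T -> nat) (Pr : T -> Prop)
    (Good : T -> rat -> Prop) :=
  ~ exists c, solves enc Pr Good c.

(*    States are 0..n-1, letters 0..k-1;                               *)
(*    wa_M = [:: M(0); ...; M(k-1)], each M(a) a list of n rows of n   *)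
(*    rational weights; wa_F = characteristic list of final states.    *)

Record WA := MkWA {
  wa_n : nat;
  wa_k : nat;
  wa_M : seq (seq (seq rat));
  wa_F : seq bool }.

Definition enc_WA (A : WA) : nat :=
  cpair (wa_n A) (cpair (wa_k A)
    (cpair (enc_list (enc_list (enc_list enc_rat)) (wa_M A))
           (enc_list nat_of_bool (wa_F A)))).

Definition weight (A : WA) (a q q' : nat) : rat :=
  nth 0%R (nth [::] (nth [::] (wa_M A) a) q) q'.

Definition wf_WA (A : WA) : Prop :=
  size (wa_M A) = wa_k A /\
  (forall a, a < wa_k A -> size (nth [::] (wa_M A) a) = wa_n A /\
     forall q, q < wa_n A -> size (nth [::] (nth [::] (wa_M A) a) q) = wa_n A) /\
  size (wa_F A) = wa_n A /\
  (forall a q q', (0 <= weight A a q q')%R).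

Definition final (A : WA) (q : nat) : bool := nth false (wa_F A) q.

Definition is_LMC (A : WA) : Prop :=
  wf_WA A /\
  (forall q, q < wa_n A -> ~~ final A q ->
     (\sum_(q' < wa_n A) \sum_(a < wa_k A) weight A a q q')%R = 1%R) /\
  (forall q, q < wa_n A -> final A q ->
     forall a q', a < wa_k A -> q' < wa_n A -> weight A a q q' = 0%R).

Section Semantics.
Variable R : realType.
Local Open Scope ring_scope.

Definition word (A : WA) := seq 'I_(wa_k A).

Definition wa_mx (A : WA) (a : 'I_(wa_k A)) : 'M[R]_(wa_n A) :=
  \matrix_(i, j) ratr (weight A a i j).

Definition prod_mx (A : WA) (w : word A) : 'M[R]_(wa_n A) :=
  foldr (fun a P => wa_mx a *m P) 1%:M w.

(* nu_s(w) = sum_{t in F} (M(a1) ... M(an))_{s,t}; 0 if s is not a state *)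
Definition nu (A : WA) (s : nat) (w : word A) : R :=
  if (insub s : option 'I_(wa_n A)) is Some i
  then \sum_(t < wa_n A | final A t) prod_mx w i t
  else 0.

Definition big_O (A : WA) (s s' : nat) : Prop :=
  exists C : R, 0 < C /\ forall w : word A, nu s w <= C * nu s' w.

Local Open Scope ereal_scope.

Definition nuE (A : WA) (s : nat) (E : set (word A)) : \bar R :=
  \esum_(w in E) (nu s w)%:E.

(* x / y with 0/0 = 0 and x/0 = +oo for x > 0 (for LMCs, nu_s(E) <= 1) *)
Definition eratio (x y : \bar R) : \bar R :=
  if y == 0 then (if x == 0 then 0 else +oo) else (fine x / fine y)%:E.

Definition tvx (A : WA) (s s' : nat) : \bar R :=
  ereal_sup [set eratio (nuE s E) (nuE s' E) | E in [set: set (word A)]].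

Definition tvx_sym (A : WA) (s s' : nat) : \bar R :=
  maxe (tvx A s s') (tvx A s' s).

End Semantics.

Definition enc3 (x : WA * nat * nat) : nat :=
  cpair (enc_WA x.1.1) (cpair x.1.2 x.2).
Definition enc4 (x : WA * nat * nat * rat) : nat :=
  cpair (enc_WA x.1.1.1) (cpair x.1.1.2 (cpair x.1.2 (enc_rat x.2))).

Definition states_ok (A : WA) (s s' : nat) := s < wa_n A /\ s' < wa_n A.

Definition bigO_problem_WA (R : realType) :=
  undecidable enc3
    (fun x => wf_WA x.1.1 /\ states_ok x.1.1 x.1.2 x.2)
    (fun x => big_O R x.1.1 x.1.2 x.2).

Definition bigO_problem_LMC (R : realType) :=
  undecidable enc3
    (fun x => is_LMC x.1.1 /\ states_ok x.1.1 x.1.2 x.2)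
    (fun x => big_O R x.1.1 x.1.2 x.2).

(* The LMC problems take inputs x = (A, s, s', r) with r a rational
   (threshold theta or precision gamma).  Promise: A is an LMC, s and s' are
   states, and the distance d (tvx or tvx_sym) is finite on (s, s'). *)
Definition bounded_promise (R : realType) (d : WA -> nat -> nat -> \bar R)
    (x : WA * nat * nat * rat) : Prop :=
  is_LMC x.1.1.1 /\ states_ok x.1.1.1 x.1.1.2 x.1.2 /\
  (d x.1.1.1 x.1.1.2 x.1.2 < +oo)%E.

Definition threshold_problem (R : realType) (d : WA -> nat -> nat -> \bar R) :=
  undecidable enc4 (bounded_promise d)
    (fun x => (d x.1.1.1 x.1.1.2 x.1.2 <= (ratr x.2 : R)%:E)%E).

Definition strict_threshold_problem (R : realType) (d : WA -> nat -> nat -> \bar R) :=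
  undecidable enc4 (bounded_promise d)
    (fun x => (d x.1.1.1 x.1.1.2 x.1.2 < (ratr x.2 : R)%:E)%E).

Definition additive_approx_task (R : realType) (d : WA -> nat -> nat -> \bar R) :=
  unsolvable enc4 (fun x => bounded_promise d x /\ (0 < x.2)%R)
    (fun x q => (`| fine (d x.1.1.1 x.1.1.2 x.1.2) - ratr q | <= (ratr x.2 : R))%R).

Definition multiplicative_approx_task (R : realType) (d : WA -> nat -> nat -> \bar R) :=
  unsolvable enc4 (fun x => bounded_promise d x /\ (0 < x.2)%R)
    (fun x q => let t := fine (d x.1.1.1 x.1.1.2 x.1.2) in
       ((1 - ratr x.2) * t <= ratr q :> R)%R /\ (ratr q <= (1 + ratr x.2) * t :> R)%R).

(* Main.v *)
Require Import Defs.
From HB Require Import structures.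
From mathcomp Require Import all_boot all_order all_algebra.
From mathcomp Require Import all_classical all_reals.
From mathcomp Require Import ereal esum.
From mathcomp Require Import zify ring lra.
From Stdlib Require Import Relation_Operators Operators_Properties.
From Stdlib Require Cantor.
Import Defs.

Set Implicit Arguments.
Unset Strict Implicit.
Unset Printing Implicit Defensive.

Import Order.TTheory GRing.Theory Num.Theory.
Local Open Scope classical_set_scope.

(** A code is compiled into a nondeterministic stack program whose only
    operations are affine assignments and tests [L = R] between affine forms of
    the stack cells; a word is a candidate run.  Along a word, the products
    [v_i v_j] of the variables evolve linearly with natural coefficients, so one
    weighted automaton can sum [2 L R] over all tests of the run, plus one, and
    another one [L^2 + R^2].  As [2 L R <= L^2 + R^2], with a defect of at least
    one when [L <> R], the first sum exceeds the second iff all tests pass.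
    Concatenating runs multiplies the weights: if the code halts on [x], the
    ratio is unbounded, and otherwise it is at most [1].  Dividing all weights by
    a common constant and sending the remaining mass to a dead state yields a
    labelled Markov chain, in which [x] occurs only in the three weights [x^2/D],
    [x/D], [1/D] of the initial step.  Mixing the two initial states with
    different proportions turns the gap into distances that are always finite,
    and at most [2] or at least [8].

    Since [x] occurs in a fixed place of the encoding, no universal machine is
    needed: an algorithm for one of the problems gives a program that fills its
    own template into itself and then contradicts the algorithm on the result. *)

(** * Partial recursive functions as set-valued maps *)

Lemma cpairE x y : cpair x y = 'C((x + y).+1, 2) + y.
Proof. by rewrite bin2 /cpair -divn2 mulnC. Qed.

Lemma cpair_cantor x y : cpair x y = Cantor.to_nat (x, y).
Proof.
have even_prod : 2 %| (x + y) * (x + y).+1 by rewrite dvdn2 oddM oddS andbN.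
by have := divnK even_prod; have := Cantor.to_nat_spec x y; rewrite /cpair; lia.
Qed.

Lemma cpair_inj x y x' y' : cpair x y = cpair x' y' -> x = x' /\ y = y'.
Proof. by rewrite !cpair_cantor => /Cantor.to_nat_inj[]. Qed.

Lemma cpair_surj z : exists x y, z = cpair x y.
Proof.
case zE: (Cantor.of_nat z) => [x y].
by exists x, y; rewrite cpair_cantor -zE Cantor.cancel_to_of.
Qed.

Lemma eval_inv c x y : eval c x y ->
  match c with
  | cZero => y = 0
  | cSucc => y = x.+1
  | cFst => exists z, x = cpair y z
  | cSnd => exists z, x = cpair z y
  | cPair f g => [set cpair a b | a in eval f x & b in eval g x] y
  | cComp f g => exists2 z, eval g x z & eval f z y
  | cRec f g => (exists2 u, x = cpair u 0 & eval f u y) \/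
      exists u n a, [/\ x = cpair u n.+1, eval (cRec f g) (cpair u n) a &
                       eval g (cpair u (cpair n a)) y]
  | cMu f => eval f (cpair x y) 0 /\
      forall m, m < y -> exists v, eval f (cpair x m) v.+1
  end.
Proof.
case=> {c x y} //.
- by move=> x y; exists y.
- by move=> x y; exists x.
- by move=> f g x a b fa gb; exists a => //; exists b.
- by move=> f g x y z gy fz; exists y.
- by move=> f g x a fa; left; exists x.
- by move=> f g x n a b ea gb; right; exists x, n, a.
Qed.

Lemma eval_cZeroE x : eval cZero x = [set 0].
Proof. by apply/seteqP; split=> [y /eval_inv|_ ->] //; constructor. Qed.

Lemma eval_cSuccE x : eval cSucc x = [set x.+1].
Proof. by apply/seteqP; split=> [y /eval_inv|_ ->] //; constructor. Qed.

Lemma eval_cFstE x y : eval cFst (cpair x y) = [set x].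
Proof.
apply/seteqP; split=> [a /eval_inv[z]|_ ->]; last exact: evFst.
by move=> /cpair_inj[->].
Qed.

Lemma eval_cSndE x y : eval cSnd (cpair x y) = [set y].
Proof.
apply/seteqP; split=> [a /eval_inv[z]|_ ->]; last exact: evSnd.
by move=> /cpair_inj[_ ->].
Qed.

Lemma eval_cPairE f g x :
  eval (cPair f g) x = [set cpair a b | a in eval f x & b in eval g x].
Proof.
by apply/seteqP; split=> [z /eval_inv //|_ [a fa [b gb <-]]]; exact: evPair.
Qed.

Lemma eval_cCompE f g x : eval (cComp f g) x = \bigcup_(y in eval g x) eval f y.
Proof.
by apply/seteqP; split=> [z /eval_inv //|z [y gy fz]]; exact: evComp gy fz.
Qed.

Lemma eval_cRec0E f g x : eval (cRec f g) (cpair x 0) = eval f x.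
Proof.
apply/seteqP; split=> [y /eval_inv[[u /cpair_inj[->]]|]|y /evRec0] //.
by move=> [u [n [a [/cpair_inj[]]]]].
Qed.

Lemma eval_cRecSE f g x n : eval (cRec f g) (cpair x n.+1) =
  \bigcup_(a in eval (cRec f g) (cpair x n)) eval g (cpair x (cpair n a)).
Proof.
apply/seteqP; split=> [y|y [a ea ga]]; last exact: evRecS ea ga.
move=> /eval_inv[[u /cpair_inj[]] //|[u [m [a [/cpair_inj[-> [->]] ea ga]]]]].
by exists a.
Qed.

Lemma eval_cMuE f x : eval (cMu f) x = [set n | eval f (cpair x n) 0 /\
  forall m, m < n -> exists v, eval f (cpair x m) v.+1].
Proof. by apply/seteqP; split=> [n /eval_inv //|n [f0 fS]]; exact: evMu. Qed.

Lemma is_subset1_eval c x : is_subset1 (eval c x).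
Proof.
elim: c x => [||||f IHf g IHg|f IHf g IHg|f IHf g IHg|f IHf] x.
- by rewrite eval_cZeroE => y z -> ->.
- by rewrite eval_cSuccE => y z -> ->.
- by have [u [v ->]] := cpair_surj x; rewrite eval_cFstE => y z -> ->.
- by have [u [v ->]] := cpair_surj x; rewrite eval_cSndE => y z -> ->.
- rewrite eval_cPairE => _ _ [a fa [b gb <-]] [a' fa' [b' gb' <-]].
  by rewrite (IHf _ _ _ fa fa') (IHg _ _ _ gb gb').
- rewrite eval_cCompE => y z [a ga fy] [b gb].
  by rewrite (IHg _ _ _ gb ga) => /(IHf _ _ _ fy).
- have [u [n ->]] := cpair_surj x; elim: n => [|n IHn].
    by rewrite eval_cRec0E; exact: IHf.
  rewrite eval_cRecSE => y z [a ea gy] [b eb].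
  by rewrite (IHn _ _ eb ea) => /(IHg _ _ _ gy).
- rewrite eval_cMuE => y z [fy0 fyS] [fz0 fzS].
  case: (ltngtP y z) => // [/fzS|/fyS] [v fv].
    by have := IHf _ _ _ fy0 fv.
  by have := IHf _ _ _ fz0 fv.
Qed.

(** * Nondeterministic affine stack programs *)

Definition store := nat -> nat.

Definition stack (l : seq nat) : store := nth 0 l.

Definition shift (d : nat) (s : store) : store := fun k => s (d + k).

Definition splice (d : nat) (s t : store) : store :=
  fun k => if k < d then s k else t (k - d).

Lemma shift_splice d s t : shift d (splice d s t) = t.
Proof.
by apply: funext => k; rewrite /shift /splice ltnNge leq_addr addKn.
Qed.

Lemma splice_shift d s : splice d s (shift d s) = s.
Proof.
by apply: funext => k; rewrite /splice /shift; case: ltnP => // /subnKC ->.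
Qed.

Lemma splice_splice d s t u : splice d (splice d s t) u = splice d s u.
Proof. by apply: funext => k; rewrite /splice; case: ltnP. Qed.

Lemma shift_shift m n s : shift m (shift n s) = shift (n + m) s.
Proof. by apply: funext => k; rewrite /shift addnA. Qed.

Lemma splice_shift_splice m n s t :
  splice n s (splice m (shift n s) t) = splice (n + m) s t.
Proof.
apply: funext => k; rewrite /splice /shift.
have [kn|nk] := ltnP k n; first by rewrite (ltn_addr m kn).
by rewrite ltn_subLR // subnDA; case: ifP => // _; rewrite subnKC.
Qed.

Lemma shift_stack l1 l2 : shift (size l1) (stack (l1 ++ l2)) = stack l2.
Proof.
by apply: funext => k; rewrite /shift /stack nth_cat ltnNge leq_addr addKn.
Qed.

Lemma splice_stack l1 l2 l3 :
  splice (size l1) (stack (l1 ++ l2)) (stack l3) = stack (l1 ++ l3).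
Proof.
by apply: funext => k; rewrite /splice /stack !nth_cat; case: ltnP.
Qed.

(* [(c, l)] is the affine form [c + \sum_(i <- l) x_i]. *)
Definition affine := (nat * seq nat)%type.

Definition aval (f : affine) (s : store) : nat := f.1 + sumn (map s f.2).

Inductive act := Assign of seq affine | Assert of affine & affine.

Definition act_sem (a : act) (s : store) : set store :=
  match a with
  | Assign fs => [set stack [seq aval f s | f <- fs]]
  | Assert f g => [set t | aval f s = aval g s /\ t = s]
  end.

Inductive prog :=
  Do of act | Seq of prog & prog | Star of prog | Frame of nat & prog.

Definition framed (d : nat) (r : store -> set store) (s : store) : set store :=
  splice d s @` r (shift d s).

Fixpoint sem (P : prog) : store -> set store :=
  match P with
  | Do a => act_sem a
  | Seq P Q => fun s => \bigcup_(t in sem P s) sem Q t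
  | Star P => clos_refl_trans store (sem P)
  | Frame d P => framed d (sem P)
  end.

Arguments sem : simpl never.

Lemma sem_star P (I : nat -> set store) :
  (forall n, \bigcup_(t in I n) sem P t = I n.+1) ->
  \bigcup_(s in I 0) sem (Star P) s = \bigcup_n I n.
Proof.
move=> IS; apply/seteqP; split=> [t [s Is]|t [n _]].
  elim/clos_refl_trans_ind_left=> [|{}t u _ [n _ It] tu]; first by exists 0.
  by exists n.+1 => //; rewrite -IS; exists t.
elim: n t => [|n IHn] t; first by exists t => //; exact: rt_refl.
rewrite -IS => -[u /IHn[s Is su] ut]; exists s => //.
exact: rt_trans su (rt_step _ _ _ _ ut).
Qed.

Lemma sem_star_orbit P (f : nat -> store) :
  (forall n, sem P (f n) = [set f n.+1]) -> sem (Star P) (f 0) = range f.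
Proof.
move=> Pf; rewrite -(bigcup_set1 (sem (Star P))) -bigcup_imset1.
by apply: (sem_star (I := fun n => [set f n])) => n; rewrite bigcup_set1.
Qed.

Lemma sem_seq P Q s : sem (Seq P Q) s = \bigcup_(t in sem P s) sem Q t.
Proof. by []. Qed.

Lemma sem_assign_seq fs Q s :
  sem (Seq (Do (Assign fs)) Q) s = sem Q (stack [seq aval f s | f <- fs]).
Proof. exact: bigcup_set1. Qed.

Lemma sem_assert_seq f g Q s :
  sem (Seq (Do (Assert f g)) Q) s = [set t | aval f s = aval g s /\ sem Q s t].
Proof.
by apply/seteqP; split=> [t [_ [fg ->]]|t [fg Qt]] //; exists s.
Qed.

Lemma sem_frame l1 (T : Type) (B : set T) (m : T -> seq nat) P l2 :
  sem P (stack l2) = [set stack (m y) | y in B] ->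
  sem (Frame (size l1) P) (stack (l1 ++ l2)) = [set stack (l1 ++ m y) | y in B].
Proof.
rewrite /sem -/sem /framed shift_stack => ->; rewrite image_comp.
by apply: eq_imagel => y _ /=; rewrite splice_stack.
Qed.

Lemma sem_frame_seq l1 Q (T : Type) (B : set T) (m : T -> seq nat) P l2 :
  sem P (stack l2) = [set stack (m y) | y in B] ->
  sem (Seq (Frame (size l1) P) Q) (stack (l1 ++ l2)) =
  \bigcup_(y in B) sem Q (stack (l1 ++ m y)).
Proof. by move=> PB; rewrite sem_seq (sem_frame _ PB) bigcup_image. Qed.

Lemma sem_frame_seq_set1 l1 Q P l2 m : sem P (stack l2) = [set stack m] ->
  sem (Seq (Frame (size l1) P) Q) (stack (l1 ++ l2)) = sem Q (stack (l1 ++ m)).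
Proof.
by move=> Pm; rewrite (@sem_frame_seq _ _ _ [set m] id) ?image_set1 ?bigcup_set1.
Qed.

Local Notation var i := (0, [:: i]) (only parsing).

Definition guess : prog :=
  Seq (Do (Assign [:: (0, [::])])) (Star (Do (Assign [:: (1, [:: 0])]))).

Lemma sem_guess s : sem guess s = [set stack [:: n] | n in setT].
Proof.
rewrite sem_assign_seq (@sem_star_orbit _ (fun n => stack [:: n])) // => n.
by rewrite /sem /= /aval /= addn0.
Qed.

Definition pairing : prog :=
  Seq (Do (Assign [:: var 0; var 1; (0, [::]); (0, [::])]))
 (Seq (Star (Do (Assign [:: var 0; var 1; (1, [:: 2]); (1, [:: 2; 3])])))
 (Seq (Do (Assert (var 2) (0, [:: 0; 1])))
      (Do (Assign [:: (0, [:: 1; 3])])))).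

Lemma sem_pairing a b : sem pairing (stack [:: a; b]) = [set stack [:: cpair a b]].
Proof.
rewrite sem_assign_seq /= /aval /= !(addn0, add0n).
rewrite sem_seq (@sem_star_orbit _ (fun n => stack [:: a; b; n; 'C(n.+1, 2)])).
  rewrite bigcup_image; apply/seteqP; split=> [t [n _]|_ ->].
    rewrite sem_assert_seq => -[]; rewrite /sem /= /aval /= !(addn0, add0n) => -> ->.
    by rewrite cpairE addnC.
  exists (a + b) => //; rewrite sem_assert_seq /sem /= /aval /= !(addn0, add0n).
  by split=> //; rewrite cpairE addnC.
move=> n; rewrite /sem /= /aval /= !(addn0, add0n, add1n).
by rewrite [in RHS]binS bin1 addnC addnS.
Qed.

Lemma sem_guess_seq l Q :
  sem (Seq (Frame (size l) guess) Q) (stack l) = \bigcup_n sem Q (stack (l ++ [:: n])).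
Proof.
rewrite -{2}[l]cats0 (@sem_frame_seq _ _ _ setT (fun n => [:: n])) //.
exact: sem_guess.
Qed.

Definition unpairing : prog :=
  Seq (Frame 1 guess)
 (Seq (Frame 2 guess)
 (Seq (Do (Assign [:: var 0; var 1; var 2; var 1; var 2]))
 (Seq (Frame 3 pairing)
 (Seq (Do (Assert (var 0) (var 3)))
      (Do (Assign [:: var 1; var 2])))))).

Lemma sem_unpairing x y :
  sem unpairing (stack [:: cpair x y]) = [set stack [:: x; y]].
Proof.
rewrite /unpairing; set Q := Seq (Do _) _.
have check a b : sem Q (stack [:: cpair x y; a; b]) =
    [set t | cpair x y = cpair a b /\ t = stack [:: a; b]].
  rewrite sem_assign_seq /aval /= !(addn0, add0n).
  rewrite (sem_frame_seq_set1 [:: _; _; _] _ (sem_pairing a b)).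
  by rewrite sem_assert_seq /sem /= /aval /= !(addn0, add0n).
rewrite (sem_guess_seq [:: _] _); apply/seteqP; split=> [t [a _]|_ ->].
  rewrite (sem_guess_seq [:: _; _] _) => -[b _].
  by rewrite check => -[/cpair_inj[<- <-] ->].
exists x => //; rewrite (sem_guess_seq [:: _; _] _); exists y => //.
by rewrite check.
Qed.

Definition computes (P : prog) (c : code) : Prop :=
  forall x, sem P (stack [:: x]) = [set stack [:: y] | y in eval c x].

Definition pair_prog (F G : prog) : prog :=
  Seq (Do (Assign [:: var 0; var 0]))
 (Seq (Frame 1 F)
 (Seq (Do (Assign [:: var 1; var 0]))
 (Seq (Frame 1 G)
      pairing))).

(* On [:: n; x; m; a]: increments [m] and replaces [a] by [G (x, (m, a))]. *)
Definition rec_step (G : prog) : prog :=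
  Seq (Do (Assign [:: var 0; var 1; (1, [:: 2]); var 1; var 2; var 3]))
 (Seq (Frame 4 pairing)
 (Seq (Frame 3 pairing)
      (Frame 3 G))).

Definition rec_prog (F G : prog) : prog :=
  Seq unpairing
 (Seq (Do (Assign [:: var 1; var 0; (0, [::]); var 0]))
 (Seq (Seq (Frame 3 F) (Star (rec_step G)))
 (Seq (Do (Assert (var 0) (var 2)))
      (Do (Assign [:: var 3]))))).

(* On [:: x; m]: increments [m] after checking that [F (x, m)] is positive. *)
Definition mu_step (F : prog) : prog :=
  Seq (Do (Assign [:: var 0; (1, [:: 1]); var 0; var 1]))
 (Seq (Frame 2 pairing)
 (Seq (Frame 2 F)
 (Seq (Frame 3 guess)
 (Seq (Do (Assert (var 2) (1, [:: 3])))
      (Do (Assign [:: var 0; var 1])))))).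

Definition mu_prog (F : prog) : prog :=
  Seq (Do (Assign [:: var 0; (0, [::])]))
 (Seq (Star (mu_step F))
 (Seq (Do (Assign [:: var 1; var 0; var 1]))
 (Seq (Frame 1 pairing)
 (Seq (Frame 1 F)
 (Seq (Do (Assert (var 1) (0, [::])))
      (Do (Assign [:: var 0]))))))).

Fixpoint compile (c : code) : prog :=
  match c with
  | cZero => Do (Assign [:: (0, [::])])
  | cSucc => Do (Assign [:: (1, [:: 0])])
  | cFst => Seq unpairing (Do (Assign [:: var 0]))
  | cSnd => Seq unpairing (Do (Assign [:: var 1]))
  | cPair f g => pair_prog (compile f) (compile g)
  | cComp f g => Seq (compile g) (compile f)
  | cRec f g => rec_prog (compile f) (compile g)
  | cMu f => mu_prog (compile f)
  end.

Section CompositePrograms.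
Variables (F G : prog) (f g : code).
Hypotheses (Ff : computes F f) (Gg : computes G g).

Lemma computes_pair : computes (pair_prog F G) (cPair f g).
Proof.
move=> x; rewrite eval_cPairE sem_assign_seq /aval /= !(addn0, add0n).
rewrite (sem_frame_seq [:: _] _ (Ff _)).
set Q := Seq _ _; have finish a :
    sem Q (stack [:: x; a]) = [set stack [:: cpair a b] | b in eval g x].
  rewrite sem_assign_seq /aval /= !(addn0, add0n).
  rewrite (sem_frame_seq [:: _] _ (Gg _)) -bigcup_imset1.
  by apply: eq_bigcupr => b _; exact: sem_pairing.
apply/seteqP; split=> [t [a fa]|_ [_ [a fa [b gb <-]] <-]].
  rewrite finish => -[b gb <-]; exists (cpair a b) => //.
  by exists a => //; exists b.
by exists a => //; rewrite finish; exists b.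
Qed.

Lemma computes_comp : computes (Seq G F) (cComp f g).
Proof.
move=> x; rewrite sem_seq Gg bigcup_image eval_cCompE image_bigcup.
by apply: eq_bigcupr => y _; exact: Ff.
Qed.

Lemma sem_rec_step n x m a : sem (rec_step G) (stack [:: n; x; m; a]) =
  [set stack [:: n; x; m.+1; b] | b in eval g (cpair x (cpair m a))].
Proof.
rewrite sem_assign_seq /aval /= !(addn0, add0n, add1n).
rewrite (sem_frame_seq_set1 [:: _; _; _; _] _ (sem_pairing m a)).
rewrite (sem_frame_seq_set1 [:: _; _; _] _ (sem_pairing x _)).
exact: (sem_frame [:: _; _; _] (Gg _)).
Qed.

Lemma sem_rec_loop n x :
  sem (Seq (Frame 3 F) (Star (rec_step G))) (stack [:: n; x; 0; x]) =
  \bigcup_m [set stack [:: n; x; m; a] | a in eval (cRec f g) (cpair x m)].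
Proof.
rewrite -(@sem_star (rec_step G)) => [|m].
  by rewrite sem_seq (sem_frame [:: _; _; _] (Ff _)) eval_cRec0E.
rewrite bigcup_image eval_cRecSE image_bigcup.
by apply: eq_bigcupr => a _; exact: sem_rec_step.
Qed.

Lemma computes_rec : computes (rec_prog F G) (cRec f g).
Proof.
move=> z; have [x [n ->]] := cpair_surj z.
rewrite sem_seq sem_unpairing bigcup_set1 sem_assign_seq /aval /= !(addn0, add0n).
rewrite sem_seq sem_rec_loop; apply/seteqP; split=> [t [_ [m _ [a ea <-]]]|_ [a ea <-]].
  rewrite sem_assert_seq /sem /= /aval /= !(addn0, add0n) => -[nm ->].
  by exists a => //; rewrite nm.
exists (stack [:: n; x; n; a]); first by exists n => //; exists a.
by rewrite sem_assert_seq /sem /= /aval /= !(addn0, add0n).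
Qed.

Lemma sem_mu_step x m : sem (mu_step F) (stack [:: x; m]) =
  [set t | (exists v, eval f (cpair x m) v.+1) /\ t = stack [:: x; m.+1]].
Proof.
rewrite sem_assign_seq /aval /= !(addn0, add0n, add1n).
rewrite (sem_frame_seq_set1 [:: _; _] _ (sem_pairing x m)).
rewrite (sem_frame_seq [:: _; _] _ (Ff _)).
set Q := Seq _ _; have check v : sem Q (stack [:: x; m.+1; v]) =
    [set t | (exists u, v = u.+1) /\ t = stack [:: x; m.+1]].
  rewrite (sem_guess_seq [:: _; _; _] _); apply/seteqP; split=> [t [u _]|t [[u ->] ->]].
    rewrite sem_assert_seq /sem /= /aval /= !(addn0, add0n) => -[-> ->].
    by split=> //; exists u.
  by exists u; rewrite // sem_assert_seq /sem /= /aval /= !(addn0, add0n).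
apply/seteqP; split=> [t [v fv]|t [[u fu] ->]].
  by rewrite check => -[[u uv] ->]; split=> //; exists u; rewrite -uv.
by exists u.+1 => //; rewrite check; split=> //; exists u.
Qed.

Lemma sem_mu_loop x : sem (Star (mu_step F)) (stack [:: x; 0]) =
  \bigcup_m [set t | (forall k, k < m -> exists v, eval f (cpair x k) v.+1) /\
                     t = stack [:: x; m]].
Proof.
rewrite -(@sem_star (mu_step F)) => [|m].
  rewrite (_ : [set t | _] = [set stack [:: x; 0]]) ?bigcup_set1 //.
  by apply/seteqP; split=> [t []//|t ->].
apply/seteqP; split=> [t [_ [fm ->]]|t [fm ->]].
  rewrite sem_mu_step => -[fmm ->]; split=> // k.
  by rewrite ltnS leq_eqVlt => /predU1P[->|/fm].
exists (stack [:: x; m]); first by split=> // k km; apply: fm; exact: ltnW.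
by rewrite sem_mu_step; split=> //; exact: fm.
Qed.

Lemma computes_mu : computes (mu_prog F) (cMu f).
Proof.
move=> x; rewrite sem_assign_seq /aval /= !(addn0, add0n) sem_seq sem_mu_loop eval_cMuE.
set Q := Seq _ _; have finish m : sem Q (stack [:: x; m]) =
    [set t | eval f (cpair x m) 0 /\ t = stack [:: m]].
  rewrite sem_assign_seq /aval /= !(addn0, add0n).
  rewrite (sem_frame_seq_set1 [:: _] _ (sem_pairing x m)).
  rewrite (sem_frame_seq [:: _] _ (Ff _)).
  apply/seteqP; split=> [t [v fv]|t [f0 ->]].
    by rewrite sem_assert_seq /sem /= /aval /= !(addn0, add0n) => -[<- ->].
  by exists 0 => //; rewrite sem_assert_seq /sem /= /aval /= !(addn0, add0n).
apply/seteqP; split=> [t [_ [m _ [fm ->]]]|_ [m [f0 fm] <-]].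
  by rewrite finish => -[f0 ->]; exists m.
by exists (stack [:: x; m]); [exists m | rewrite finish].
Qed.

End CompositePrograms.

Lemma computes_compile c : computes (compile c) c.
Proof.
elim: c => [||||f Ff g Gg|f Ff g Gg|f Ff g Gg|f Ff] /=.
- by move=> x; rewrite eval_cZeroE image_set1.
- by move=> x; rewrite eval_cSuccE image_set1 /sem /= /aval /= addn0.
- move=> z; have [x [y ->]] := cpair_surj z; rewrite eval_cFstE image_set1.
  by rewrite sem_seq sem_unpairing bigcup_set1 /sem /= /aval /= addn0.
- move=> z; have [x [y ->]] := cpair_surj z; rewrite eval_cSndE image_set1.
  by rewrite sem_seq sem_unpairing bigcup_set1 /sem /= /aval /= addn0.
- exact: computes_pair.
- exact: computes_comp.
- exact: computes_rec.
- exact: computes_mu.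
Qed.

(** * Control flow *)

Definition act_code (a : act) : seq affine + affine * affine :=
  match a with Assign fs => inl fs | Assert f g => inr (f, g) end.

Definition act_decode (x : seq affine + affine * affine) : act :=
  match x with inl fs => Assign fs | inr (f, g) => Assert f g end.

Lemma act_codeK : cancel act_code act_decode.
Proof. by case. Qed.

HB.instance Definition _ := Countable.copy act (can_type act_codeK).

Fixpoint prog_code (P : prog) : GenTree.tree act :=
  match P with
  | Do a => GenTree.Leaf a
  | Seq P Q => GenTree.Node 0 [:: prog_code P; prog_code Q]
  | Star P => GenTree.Node 1 [:: prog_code P]
  | Frame d P => GenTree.Node d.+2 [:: prog_code P]
  end.

Fixpoint prog_decode (t : GenTree.tree act) : prog :=
  match t with
  | GenTree.Leaf a => Do a
  | GenTree.Node 0 [:: t; u] => Seq (prog_decode t) (prog_decode u)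
  | GenTree.Node 1 [:: t] => Star (prog_decode t)
  | GenTree.Node d.+2 [:: t] => Frame d (prog_decode t)
  | _ => Do (Assign [::])
  end.

Lemma prog_codeK : cancel prog_code prog_decode.
Proof. by elim=> //= [P -> Q ->|P ->|d P ->]. Qed.

HB.instance Definition _ := Countable.copy prog (can_type prog_codeK).

Definition command := (nat * act)%type.

Definition command_sem (c : command) : store -> set store := framed c.1 (act_sem c.2).

Definition edge := (nat * command * nat)%type.

Record flowchart := Flowchart { edges : seq edge; entry : nat; exit : nat }.

Definition config := (nat * store)%type.

Definition flow_step (E : seq edge) (x y : config) : Prop :=
  exists2 c, (x.1, c, y.1) \in E & command_sem c x.2 y.2.

Definition reaches (E : seq edge) : config -> config -> Prop :=
  clos_refl_trans config (flow_step E).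

Definition halts_on (M : flowchart) (x : nat) : Prop :=
  exists t, reaches (edges M) (entry M, stack [:: x]) (exit M, t).

(* The programs that remain to be run, each with its depth.  They serve as the
   control points, so that the soundness of [flow] is checked edge by edge. *)
Definition continuation := seq (nat * prog).

Fixpoint cont_sem (k : continuation) (s : store) : set store :=
  match k with
  | [::] => [set s]
  | (d, P) :: k' => \bigcup_(t in framed d (sem P) s) cont_sem k' t
  end.

Definition node (k : continuation) : nat := pickle k.

Definition skip : command := (0, Assert (0, [::]) (0, [::])).

Fixpoint flow (d : nat) (P : prog) (k : continuation) : seq edge :=
  let here := node ((d, P) :: k) in
  match P with
  | Do a => [:: (here, (d, a), node k)]
  | Seq P Q => (here, skip, node [:: (d, P), (d, Q) & k]) ::
      flow d P ((d, Q) :: k) ++ flow d Q k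
  | Star P' => [:: (here, skip, node k), (here, skip, node [:: (d, P'), (d, P) & k]) &
      flow d P' ((d, P) :: k)]
  | Frame n P => (here, skip, node ((d + n, P) :: k)) :: flow (d + n) P k
  end.

Definition program_flowchart (P : prog) : flowchart :=
  Flowchart (flow 0 P [::]) (node [:: (0, P)]) (node [::]).

Lemma node_inj : injective node.
Proof. exact: pcan_inj pickleK. Qed.

Lemma command_sem_skip s : command_sem skip s = [set s].
Proof.
apply/seteqP; split=> [_ [_ [_ ->] <-]|_ ->]; first by rewrite splice_shift.
by exists s => //; rewrite splice_shift.
Qed.

Lemma framed0 r s : framed 0 r s = r s.
Proof.
have splice0 t : splice 0 s t = t by apply: funext => k; rewrite /splice subn0.
by apply/seteqP; split=> [_ [t rt <-]|t rt]; [rewrite splice0|exists t].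
Qed.

Lemma framed_seq d P Q s :
  framed d (sem (Seq P Q)) s = \bigcup_(t in framed d (sem P) s) framed d (sem Q) t.
Proof.
rewrite /framed sem_seq image_bigcup bigcup_image; apply: eq_bigcupr => t _.
by rewrite shift_splice; apply: eq_imagel => u _; rewrite splice_splice.
Qed.

Lemma framed_frame d n P s : framed d (sem (Frame n P)) s = framed (d + n) (sem P) s.
Proof.
rewrite /framed /sem /= /framed image_comp shift_shift addnC.
by apply: eq_imagel => t _; rewrite /= splice_shift_splice addnC.
Qed.

Lemma framed_star_refl d P s : framed d (sem (Star P)) s s.
Proof. by exists (shift d s); [exact: rt_refl | exact: splice_shift]. Qed.

Lemma framed_star_step d P s t :
  framed d (sem P) s t -> framed d (sem (Star P)) t `<=` framed d (sem (Star P)) s.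
Proof.
move=> [u su <-] _ [v uv <-]; rewrite splice_splice; exists v => //.
by rewrite shift_splice in uv; exact: rt_trans (rt_step _ _ _ _ su) uv.
Qed.

Lemma flow_sound d P k p c q : (p, c, q) \in flow d P k ->
  exists k1 k2, [/\ p = node k1, q = node k2 &
    forall s t, command_sem c s t -> cont_sem k2 t `<=` cont_sem k1 s].
Proof.
elim: P d k => [a|P IHP Q IHQ|P IHP|n P IHP] d k /=.
- rewrite inE => /eqP[-> -> ->]; exists ((d, Do a) :: k), k; split=> // s t st u tu.
  by exists t.
- rewrite inE mem_cat => /predU1P[[-> -> ->]|/orP[/IHP|/IHQ]] //.
  exists ((d, Seq P Q) :: k), [:: (d, P), (d, Q) & k]; split=> // s t.
  rewrite command_sem_skip => -> u [v sv [w vw wu]]; exists w => //.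
  by rewrite framed_seq; exists v.
- rewrite !inE => /predU1P[[-> -> ->]|/predU1P[[-> -> ->]|/IHP]] //.
    exists ((d, Star P) :: k), k; split=> // s t; rewrite command_sem_skip => -> u su.
    by exists s => //; exact: framed_star_refl.
  exists ((d, Star P) :: k), [:: (d, P), (d, Star P) & k]; split=> // s t.
  rewrite command_sem_skip => -> u [v sv [w vw wu]]; exists w => //.
  exact: framed_star_step sv _ vw.
- rewrite inE => /predU1P[[-> -> ->]|/IHP] //.
  exists ((d, Frame n P) :: k), ((d + n, P) :: k); split=> // s t.
  by rewrite command_sem_skip => -> /=; rewrite framed_frame.
Qed.

Lemma reaches_sub E E' x y : {subset E <= E'} -> reaches E x y -> reaches E' x y.
Proof.
move=> sEE'; elim=> {x y} [x y [c /sEE' cE xy]|x|x y z _ xy _ yz].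
- by apply: rt_step; exists c.
- exact: rt_refl.
- exact: rt_trans xy yz.
Qed.

Lemma reaches_skip E p q s : (p, skip, q) \in E -> reaches E (p, s) (q, s).
Proof. by move=> e; apply: rt_step; exists skip; rewrite // command_sem_skip. Qed.

Lemma flow_complete d P k s t : framed d (sem P) s t ->
  reaches (flow d P k) (node ((d, P) :: k), s) (node k, t).
Proof.
elim: P d k s t => [a|P IHP Q IHQ|P IHP|n P IHP] d k s t.
- by move=> st; apply: rt_step; exists (d, a) => //=; rewrite inE.
- rewrite framed_seq => -[u /IHP su /IHQ ut].
  have enter : reaches (flow d (Seq P Q) k) (node ((d, Seq P Q) :: k), s)
      (node [:: (d, P), (d, Q) & k], s) by apply: reaches_skip; rewrite /= inE eqxx.
  apply: rt_trans enter _.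
  apply: rt_trans; [apply: reaches_sub (su ((d, Q) :: k))|apply: reaches_sub (ut k)];
    by move=> e eP; rewrite /= inE mem_cat eP ?orbT.
- set E := flow _ _ _; set c := (d, Star P) :: k.
  have enter u : reaches E (node c, u) (node ((d, P) :: c), u).
    by apply: reaches_skip; rewrite /E /= !inE eqxx orbT.
  have leave u : reaches E (node c, u) (node k, u).
    by apply: reaches_skip; rewrite /E /= !inE eqxx.
  case=> u run <-; apply: rt_trans (leave _).
  elim/clos_refl_trans_ind_left: run => [|v w _ IH vw].
    by rewrite splice_shift; exact: rt_refl.
  apply: rt_trans IH _; apply: rt_trans (enter _) _.
  apply: (@reaches_sub (flow d P c)) => [e eP|]; first by rewrite /E /= !inE eP !orbT.
  by apply: IHP; exists w; rewrite ?shift_splice // splice_splice.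
- rewrite framed_frame => /IHP run.
  have enter : reaches (flow d (Frame n P) k) (node ((d, Frame n P) :: k), s)
      (node ((d + n, P) :: k), s) by apply: reaches_skip; rewrite /= inE eqxx.
  apply: rt_trans enter _.
  by apply: reaches_sub (run k) => e eP; rewrite /= inE eP orbT.
Qed.

Lemma program_flowchartP P x :
  halts_on (program_flowchart P) x <-> sem P (stack [:: x]) !=set0.
Proof.
split=> [[t run]|[t]]; last first.
  by rewrite -framed0 => /flow_complete run; exists t; exact: run.
suff : cont_sem [:: (0, P)] (stack [:: x]) t.
  by move=> [u + _]; rewrite framed0; exists u.
pose good (y : config) := forall k, y.1 = node k -> cont_sem k y.2 t.
suff good0 : good (node [:: (0, P)], stack [:: x]) by exact: good0.
elim/clos_refl_trans_ind_right: run => [k /node_inj <-//|[p s] [q u]].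
move=> [c /flow_sound[k1 [k2 [/= -> -> step]]] su] IH _ k /node_inj <-.
by apply: step su _ _; exact: IH.
Qed.

Definition halting_flowchart (c : code) : flowchart := program_flowchart (compile c).

Lemma halting_flowchartP c x : halts_on (halting_flowchart c) x <-> eval c x !=set0.
Proof.
rewrite program_flowchartP computes_compile.
by split; [exact: nonempty_image | exact: image_nonempty].
Qed.

(** * Tests as comparisons of quadratic costs *)

(* Variable [0] is the control point, variable [1] is constantly one, and
   variable [k.+2] is the cell [k]. *)
Definition snapshot (p : nat) (s : store) : nat -> nat :=
  fun k => match k with 0 => p | 1 => 1 | k'.+2 => s k' end.

(* A linear form is the list of its variables, each repeated according to its
   coefficient. *)
Definition lval (l : seq nat) (v : nat -> nat) : nat := sumn (map v l).

Definition linear (d : nat) (f : affine) : seq nat :=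
  nseq f.1 1 ++ [seq (d + i).+2 | i <- f.2].

Definition test := (seq nat * seq nat)%type.

Definition passes (ts : seq test) (v : nat -> nat) : bool :=
  all (fun t => lval t.1 v == lval t.2 v) ts.

Definition position_test (p : nat) : test := ([:: 0], nseq p 1).

Definition tests (e : edge) : seq test :=
  let: (p, (d, a), q) := e in
  position_test p :: if a is Assert f g then [:: (linear d f, linear d g)] else [::].

Definition update (e : edge) (k : nat) : seq nat :=
  let: (p, (d, a), q) := e in
  match k, a with
  | 0, _ => nseq q 1
  | k'.+2, Assign fs => if k' < d then [:: k] else linear d (nth (0, [::]) fs (k' - d))
  | _, _ => [:: k]
  end.

Definition advance (e : edge) (v : nat -> nat) : nat -> nat :=
  fun k => lval (update e k) v.

Lemma lval1 k v : lval [:: k] v = v k.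
Proof. exact: addn0. Qed.

Lemma lval_ones n p s : lval (nseq n 1) (snapshot p s) = n.
Proof. by rewrite /lval map_nseq sumn_nseq mul1n. Qed.

Lemma lval_linear d f p s : lval (linear d f) (snapshot p s) = aval f (shift d s).
Proof.
rewrite /lval map_cat sumn_cat -/(lval _ _) lval_ones.
by rewrite /aval -map_comp.
Qed.

Lemma advance_one e v : advance e v 1 = v 1.
Proof. by case: e => -[p [d a]] q; rewrite /advance lval1. Qed.

Lemma advance_snapshot p c q p' s t : command_sem c s t ->
  advance (p, c, q) (snapshot p' s) = snapshot q t.
Proof.
case: c => d a [u au <-]; apply: funext => -[|[|k]]; rewrite /advance /=.
- exact: lval_ones.
- exact: lval1.
case: a au => [fs ->|f g [_ ->]]; last by rewrite lval1 /= splice_shift.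
rewrite /splice; case: ltnP => dk; first exact: lval1.
rewrite lval_linear /stack; have [lt|ge] := ltnP (k - d) (size fs).
  by rewrite (nth_map (0, [::])).
by rewrite !nth_default ?size_map.
Qed.

Lemma passes_position p p' s : passes [:: position_test p] (snapshot p' s) = (p' == p).
Proof. by rewrite /passes /= lval1 lval_ones andbT. Qed.

Lemma passes_tests p c q p' s :
  passes (tests (p, c, q)) (snapshot p' s) <-> p' = p /\ exists t, command_sem c s t.
Proof.
case: c => d a; rewrite /passes /= lval1 lval_ones /=; split.
  case/andP=> /eqP -> pa; split=> //; case: a pa => [fs|f g] /=.
    by do 2!eexists; [reflexivity|].
  rewrite andbT !lval_linear => /eqP fg.
  by exists s; exists (shift d s); [|exact: splice_shift].
case=> -> [t [u au _]]; rewrite eqxx; case: a au => //= f g [fg _].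
by rewrite !lval_linear fg eqxx.
Qed.

(* The two sides of [2 L R <= L^2 + R^2], which are equal iff [L = R]. *)
Definition cost (b : bool) (ts : seq test) (v : nat -> nat) : nat :=
  \sum_(t <- ts) (if b then lval t.1 v ^ 2 + lval t.2 v ^ 2
                  else 2 * (lval t.1 v * lval t.2 v)).

Lemma cost_eq ts v : passes ts v -> cost false ts v = cost true ts v.
Proof.
move=> /allP pts; apply: eq_big_seq => t /pts /eqP ->.
by rewrite mulnn addnn mul2n.
Qed.

Lemma cost_leq ts v : cost false ts v <= cost true ts v.
Proof. by apply: leq_sum => t _; exact: nat_Cauchy. Qed.

Lemma cost_lt ts v : ~~ passes ts v -> cost false ts v < cost true ts v.
Proof.
elim: ts => [//|t ts IH] /=; rewrite negb_and /cost !big_cons -!/(cost _ _ _).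
case/orP=> [ne|/IH lt]; last first.
  by rewrite -addnS; apply: leq_add => //; exact: nat_Cauchy.
rewrite -addSn; apply: leq_add; last exact: cost_leq.
by rewrite (ltn_leqif (nat_Cauchy _ _)).
Qed.

Definition test_vars (t : test) : seq nat := t.1 ++ t.2.

Definition edge_vars (e : edge) : seq nat :=
  flatten (map test_vars (tests e)) ++
  (if e.1.2.2 is Assign fs then flatten (map (linear e.1.2.1) fs) else [::]).

Definition dimension (E : seq edge) : nat :=
  \max_(i <- flatten (map edge_vars E)) i + 3.

Lemma dimension_gt2 E : 2 < dimension E.
Proof. by rewrite /dimension addn3. Qed.

Lemma edge_vars_bound E e : e \in E -> all (gtn (dimension E)) (edge_vars e).
Proof.
move=> eE; apply/allP => i ie; rewrite /= /dimension addn3 ltnS leqW // leqW //.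
apply: (leq_bigmax_seq (F := id)) => //; apply/flattenP.
by exists (edge_vars e); rewrite ?map_f.
Qed.

Lemma tests_bound E e t : e \in E -> t \in tests e ->
  all (gtn (dimension E)) (test_vars t).
Proof.
move=> eE te; apply/allP => i it; apply: (allP (edge_vars_bound eE)).
by rewrite mem_cat; apply/orP; left; apply/flatten_mapP; exists t.
Qed.

Lemma update_bound E e k : e \in E -> k < dimension E ->
  all (gtn (dimension E)) (update e k).
Proof.
move=> /edge_vars_bound; case: e => -[p [d a]] q; rewrite all_cat => /andP[_].
have r2 := dimension_gt2 E.
case: k => [|[|k]] /=; first by move=> _ _; apply/allP => i /nseqP[-> _]; exact: ltnW.
  by move=> _ ->.
case: a => [fs|f g] /=; last by move=> _ ->.
move=> /allP okfs kr; case: ltnP => _ /=; first by rewrite kr.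
have [lt|ge] := ltnP (k - d) (size fs); last by rewrite nth_default.
apply/allP => i il; apply: okfs; apply/flatten_mapP.
by exists (nth (0, [::]) fs (k - d)) => //; exact: mem_nth.
Qed.

Lemma position_test_bound E p : all (gtn (dimension E)) (test_vars (position_test p)).
Proof.
have r2 := dimension_gt2 E.
by apply/allP => i; rewrite mem_cat inE => /orP[/eqP->|/nseqP[->]] /=; lia.
Qed.

Definition pairs (r : nat) : seq (nat * nat) :=
  [seq (i, j) | i <- iota 0 r, j <- iota 0 r].

Lemma mem_pairs r i j : ((i, j) \in pairs r) = (i < r) && (j < r).
Proof.
apply/allpairsP/andP => [[[k l] /= []]|[ir jr]].
  by rewrite !mem_iota => kr lr [-> ->].
by exists (i, j); rewrite /= !mem_iota.
Qed.

Lemma lval_sum r l v : all (gtn r) l ->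
  lval l v = \sum_(i <- iota 0 r) v i * count_mem i l.
Proof.
elim: l => [|k l IHl] /=; first by rewrite big1 // => i _; rewrite muln0. 
case/andP=> kr /IHl IH; rewrite /lval /= -/(lval l v) IH.
under [RHS]eq_bigr => i _ do rewrite mulnDr.
rewrite big_split /=; congr (_ + _).
rewrite (bigD1_seq k) ?iota_uniq ?mem_iota //= eqxx muln1 big1 ?addn0 //.
by move=> i /negPf; rewrite eq_sym => ->; rewrite muln0.
Qed.

Lemma lval_mul r l l' v : all (gtn r) l -> all (gtn r) l' ->
  lval l v * lval l' v =
  \sum_(ij <- pairs r) v ij.1 * v ij.2 * (count_mem ij.1 l * count_mem ij.2 l').
Proof.
move=> lr lr'; rewrite !(@lval_sum r) // big_allpairs /= big_distrlr /=.
by do 2!apply: eq_bigr => ? _; rewrite mulnACA.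
Qed.

Definition cost_coef (b : bool) (ts : seq test) (i j : nat) : nat :=
  \sum_(t <- ts)
    (if b then count_mem i t.1 * count_mem j t.1 + count_mem i t.2 * count_mem j t.2
     else 2 * (count_mem i t.1 * count_mem j t.2)).

Lemma costE r b ts v : (forall t, t \in ts -> all (gtn r) (test_vars t)) ->
  cost b ts v = \sum_(ij <- pairs r) v ij.1 * v ij.2 * cost_coef b ts ij.1 ij.2.
Proof.
move=> okts; under eq_bigr => ij _ do rewrite big_distrr /=.
rewrite exchange_big; apply: eq_big_seq => t /okts; rewrite all_cat => /andP[t1 t2].
case: b => /=; last first.
  by rewrite (@lval_mul r) // big_distrr; apply: eq_bigr => ij _; exact: mulnCA.
rewrite -!mulnn !(@lval_mul r) // -big_split.
by apply: eq_bigr => ij _; rewrite mulnDr.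
Qed.

(** * Automata given by lists of states and letters *)

Section Automaton.
Variables (S L : eqType) (states : seq S) (letters : seq L) (s0 : S) (a0 : L).
Variables (wt : L -> S -> S -> rat) (fin : pred S).
Local Open Scope ring_scope.

Definition automaton : WA :=
  MkWA (size states) (size letters)
    [seq [seq [seq wt a p q | q <- states] | p <- states] | a <- letters]
    (map fin states).

Fixpoint value (p : S) (w : seq L) : rat :=
  if w is a :: w' then \sum_(q <- states) wt a p q * value q w' else (fin p)%:R.

Lemma value_cons p a w :
  value p (a :: w) = \sum_(q <- states) wt a p q * value q w.
Proof. by []. Qed.

Definition spell (w : word automaton) : seq L :=
  [seq nth a0 letters (nat_of_ord a) | a <- w].

Lemma weight_automaton a i j :
  (a < size letters)%N -> (i < size states)%N -> (j < size states)%N ->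
  weight automaton a i j = wt (nth a0 letters a) (nth s0 states i) (nth s0 states j).
Proof.
by move=> la li lj; rewrite /weight (nth_map a0) // (nth_map s0) // (nth_map s0).
Qed.

Lemma final_automaton i : (i < size states)%N ->
  final automaton i = fin (nth s0 states i).
Proof. by move=> li; rewrite /final (nth_map s0). Qed.

Lemma automaton_wf :
  (forall a p q, p \in states -> 0 <= wt a p q) -> wf_WA automaton.
Proof.
move=> wt_ge0; split; first by rewrite size_map.
split=> [a la|].
  rewrite (nth_map a0) // size_map; split=> // q lq.
  by rewrite (nth_map s0) // size_map.
split=> [|a i j]; first by rewrite size_map.
have [la|la] := ltnP a (size letters); last first.
  by rewrite /weight [nth _ _ a]nth_default ?size_map // !nth_nil.
have [li|li] := ltnP i (size states); last first.
  by rewrite /weight (nth_map a0) // [nth _ _ i]nth_default ?size_map // nth_nil.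
have [lj|lj] := ltnP j (size states); last first.
  by rewrite /weight (nth_map a0) // (nth_map s0) // nth_default ?size_map.
by rewrite weight_automaton // wt_ge0 // mem_nth.
Qed.

Lemma automaton_LMC : (forall a p q, p \in states -> 0 <= wt a p q) ->
  (forall p, ~~ fin p -> \sum_(q <- states) \sum_(a <- letters) wt a p q = 1) ->
  (forall a p q, fin p -> wt a p q = 0) -> is_LMC automaton.
Proof.
move=> wt_ge0 row_sum fin_row; split; first exact: automaton_wf.
split=> i li; rewrite final_automaton // => fi.
  rewrite -(row_sum _ fi) (big_nth s0) big_mkord; apply: eq_bigr => j _.
  rewrite (big_nth a0) big_mkord; apply: eq_bigr => a _.
  exact: weight_automaton.
by move=> a j la lj; rewrite weight_automaton // fin_row.
Qed.

Lemma value_ge0 p w : (forall a p q, p \in states -> 0 <= wt a p q) ->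
  p \in states -> 0 <= value p w.
Proof.
move=> wt_ge0; elim: w p => [|a w IHw] p ps; first exact: ler0n.
by rewrite /= big_seq; apply: sumr_ge0 => q qs; rewrite mulr_ge0 ?wt_ge0 ?IHw.
Qed.

Lemma spell_letters w : {subset spell w <= letters}.
Proof. by move=> _ /mapP[a _ ->]; exact: mem_nth. Qed.

Lemma spell_surj lw : {subset lw <= letters} -> exists w, spell w = lw.
Proof.
elim: lw => [|a lw IHlw] lwL; first by exists [::].
have [w <-] := IHlw (fun b bw => lwL b (mem_behead (s := a :: lw) bw)).
have la : (index a letters < wa_k automaton)%N by rewrite index_mem lwL ?mem_head.
by exists (Ordinal la :: w); rewrite /= nth_index ?lwL ?mem_head.
Qed.

Lemma nu_automaton (R : realType) i (w : word automaton) : (i < size states)%N ->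
  nu R i w = ratr (value (nth s0 states i) (spell w)).
Proof.
move=> li; rewrite /nu (insubT (fun i => (i < wa_n automaton)%N) li).
set j : 'I_(wa_n automaton) := Sub i li; rewrite -[i in RHS]/(nat_of_ord j).
elim: w (j) => {j li i} [|a w IHw] i.
  rewrite (eq_bigr _ (fun t _ => mxE _ _ i t)) /= -final_automaton // ratr_nat.
  rewrite big_mkcond (bigD1 i) // eqxx big1 => [|t /negPf ti].
    by rewrite [LHS]addr0; case: (final automaton i).
  by rewrite eq_sym ti if_same.
have prodE t : prod_mx R (a :: w) i t = \sum_j wa_mx R a i j * prod_mx R w j t.
  by rewrite -[prod_mx R (a :: w)]/(wa_mx R a *m prod_mx R w) mxE.
rewrite (eq_bigr _ (fun t _ => prodE t)) exchange_big [value _ _]/=.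
rewrite (big_nth s0) big_mkord rmorph_sum.
apply: eq_bigr => j _; rewrite rmorphM -[LHS]mulr_sumr IHw mxE.
by rewrite -weight_automaton.
Qed.

End Automaton.

(** * Total variation distances *)

Section TotalVariation.
Variables (R : realType) (A : WA).
Hypothesis A_wf : wf_WA A.
Local Open Scope ring_scope.

Lemma prod_mx_ge0 (w : word A) i j : 0 <= prod_mx R w i j.
Proof.
elim: w i => [|a w IHw] i; rewrite /= mxE; first by case: eqP; rewrite ?ler01 ?lexx.
apply: sumr_ge0 => k _; rewrite mulr_ge0 // mxE ler0q.
by have [_ [_ [_ ->]]] := A_wf.
Qed.

Lemma nu_ge0 s (w : word A) : 0 <= nu R s w.
Proof.
rewrite /nu; case: insubP => [i _ _|//].
by apply: sumr_ge0 => t _; exact: prod_mx_ge0.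
Qed.

Lemma nuE_ge0 s (E : set (word A)) : (0 <= nuE R s E)%E.
Proof. by apply: esum_ge0 => w _; rewrite lee_fin nu_ge0. Qed.

Lemma le_nuE s s' (K : R) (E : set (word A)) : 0 <= K ->
  (forall w : word A, nu R s w <= K * nu R s' w) ->
  (nuE R s E <= K%:E * nuE R s' E)%E.
Proof.
move=> K0 le_nu; apply: ge_ereal_sup => _ [X [finX XE] <-].
apply: (@le_trans _ _ (K%:E * \sum_(w \in X) (nu R s' w)%:E)%E); last first.
  by rewrite lee_wpmul2l ?lee_fin // esum_ge //; exists X.
rewrite ge0_mule_fsumr => [|w]; last by rewrite lee_fin nu_ge0.
by apply: lee_fsum => // w _; rewrite -EFinM lee_fin.
Qed.

Lemma eratio_le (x y : \bar R) (K : R) : (0 <= x)%E -> (0 <= y)%E -> 0 <= K ->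
  (x <= K%:E * y)%E -> (eratio x y <= K%:E)%E.
Proof.
rewrite /eratio => x0 y0 K0; case: eqP => [-> |_].
  by rewrite mule0 => x0'; rewrite eq_le x0 x0' lee_fin.
case: y y0 => [y||] //= y0; rewrite ?invr0 ?mulr0 ?lee_fin //.
rewrite lee_fin in y0; case: x x0 => [x||] // x0; rewrite -?EFinM lee_fin //= => xKy.
have [->|yn0] := eqVneq y 0; first by rewrite invr0 mulr0.
by rewrite ler_pdivrMr // lt0r yn0.
Qed.

Lemma tvx_le s s' (K : R) : 0 <= K ->
  (forall w : word A, nu R s w <= K * nu R s' w) -> (tvx R A s s' <= K%:E)%E.
Proof.
move=> K0 le_nu; apply: ge_ereal_sup => _ [E _ <-].
by apply: eratio_le; rewrite ?nuE_ge0 // le_nuE.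
Qed.

Lemma tvx_ge s s' (c : R) (w : word A) : 0 < nu R s' w ->
  c * nu R s' w <= nu R s w -> (c%:E <= tvx R A s s')%E.
Proof.
move=> w0 le_c; apply: le_ereal_sup_tmp.
exists (eratio (nuE R s [set w]) (nuE R s' [set w])); first by exists [set w].
rewrite /nuE !esum_set1 ?lee_fin ?nu_ge0 // /eratio eqe gt_eqF //=.
by rewrite lee_fin ler_pdivlMr.
Qed.

Lemma tvx_ge0 s s' : (0 <= tvx R A s s')%E.
Proof.
apply: le_ereal_sup_tmp; exists (eratio (@nuE R A s set0) (@nuE R A s' set0)).
  by exists set0.
by rewrite /nuE !esum_set0 /eratio !eqxx.
Qed.

End TotalVariation.

(** * The labelled Markov chain of a flowchart *)

Lemma exp_succ_gap F K : exists m, K * F ^ m.+1 < F.+1 ^ m.+1.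
Proof.
have bernoulli m : F ^ m * (F + m) <= F * F.+1 ^ m.
  elim: m => [|m IHm]; first by rewrite !expn0; lia.
  have -> : F ^ m.+1 * (F + m.+1) = F ^ m * (F * (F + m.+1)) by rewrite expnS; lia.
  apply: (@leq_trans (F ^ m * ((F + m) * F.+1))).
    by rewrite leq_mul2l; apply/orP; right; nia.
  by rewrite mulnA expnSr mulnA leq_mul2r IHm orbT.
exists (K * F); have [->|F0] := posnP F; first by rewrite exp0n // muln0 exp1n.
rewrite -(ltn_pmul2l F0); apply: leq_trans (bernoulli _).
have : 0 < F ^ (K * F).+1 by rewrite expn_gt0 F0.
by set X := F ^ _; nia.
Qed.

Inductive letter := Start | Expand | Restart | Stop | Draw | Cmd of edge.

HB.instance Definition _ := gen_eqMixin letter.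

(* [Vec b i j] carries the product of the machine variables [i] and [j], and
   [Acc b] the accumulated value of [cost b]; [Root false] and [Root true] are
   the states to be compared, and [Mix b] starts a mixture of them. *)
Inductive state :=
| Root of bool | Mix of bool | Ini of bool & nat | Fin | Dead
| Acc of bool | Vec of bool & nat & nat.

HB.instance Definition _ := gen_eqMixin state.

Definition is_fin (p : state) : bool := if p is Fin then true else false.

Section Chain.
Variables (M : flowchart) (x : nat).
Local Notation r := (dimension (edges M)).

Definition initial_vars : nat -> nat := snapshot (entry M) (stack [:: x]).

(* The extra one that [Root false] gets decides between [cost false] and
   [cost true]. *)
Definition final_cost (b : bool) (v : nat -> nat) : nat :=
  cost b [:: position_test (exit M)] v + ~~ b * (v 1 * v 1).

Definition final_coef (b : bool) (i j : nat) : nat :=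
  cost_coef b [:: position_test (exit M)] i j + [&& ~~ b, i == 1 & j == 1].

(* Coefficients of [x ^ (2 - n)] in the product of the initial values of the
   variables [i] and [j]. *)
Definition initial_coef (n i j : nat) : nat :=
  let u := snapshot (entry M) (stack [::]) in
  match n with
  | 0 => (i == 2) * (j == 2)
  | 1 => (i == 2) * u j + u i * (j == 2)
  | _ => u i * u j
  end.

Arguments initial_coef : simpl never.

Definition int_weight (a : letter) (p q : state) : nat :=
  match a, p, q with
  | Expand, Ini b n, Vec b' i j => (b == b') * initial_coef n i j
  | Restart, Acc b, Root b' => b == b'
  | Restart, Vec b i j, Root b' => (b == b') * final_coef b i j
  | Stop, Acc b, Fin => 1
  | Stop, Vec b i j, Fin => final_coef b i j
  | Cmd e, Acc b, Acc b' => b == b'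
  | Cmd e, Vec b i j, Acc b' => (b == b') * cost_coef b (tests e) i j
  | Cmd e, Vec b i j, Vec b' k l =>
      (b == b') * (count_mem i (update e k) * count_mem j (update e l))
  | _, _, _ => 0
  end.

Definition vecs (b : bool) : seq state := [seq Vec b ij.1 ij.2 | ij <- pairs r].

Definition states : seq state :=
  [:: Root false; Root true; Mix false; Mix true;
      Ini false 0; Ini false 1; Ini false 2; Ini true 0; Ini true 1; Ini true 2;
      Fin; Dead; Acc false; Acc true] ++ vecs false ++ vecs true.

Definition letters : seq letter :=
  [:: Start; Expand; Restart; Stop; Draw] ++ map Cmd (edges M).

Definition row_total (p : state) : nat :=
  \sum_(q <- states) \sum_(a <- letters) int_weight a p q.

Definition scale : nat := (\sum_(p <- states) row_total p).+1.

Definition denom : nat := x * x + x + 1.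

Local Open Scope ring_scope.

Definition start_weight (n : nat) : rat :=
  match n with
  | 0%N => (x * x)%:R / denom%:R
  | 1%N => x%:R / denom%:R
  | _ => 1 / denom%:R
  end.

(* The ratio of [(u + v) / 2] and [(u + 31 v) / 32] is at most [16] in general, at
   most [2] if [u <= v], and at least [8] if [29 v <= u]. *)
Definition mix_weight (b b' : bool) : rat :=
  if b then (if b' then 31 / 32 else 1 / 32) else 1 / 2.

Definition slack (a : letter) (p q : state) : rat :=
  match a, q with Expand, Dead => 1 - (row_total p)%:R / scale%:R | _, _ => 0 end.

Definition chain_weight (a : letter) (p q : state) : rat :=
  match p with
  | Fin => 0
  | Root b =>
      match a, q with
      | Start, Ini b' n => if b == b' then start_weight n else 0
      | _, _ => 0
      end
  | Mix b => match a, q with Draw, Root b' => mix_weight b b' | _, _ => 0 end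
  | _ => (int_weight a p q)%:R / scale%:R + slack a p q
  end.

Definition chain : WA := automaton states letters chain_weight is_fin.

Local Notation cval := (value states chain_weight is_fin).

Definition ordinary (p : state) : bool :=
  match p with Fin | Root _ | Mix _ => false | _ => true end.

Lemma chain_weight_ordinary a p q : ordinary p ->
  chain_weight a p q = (int_weight a p q)%:R / scale%:R + slack a p q.
Proof. by case: p. Qed.

Lemma scale_gt0 : 0 < scale%:R :> rat.
Proof. by rewrite ltr0n. Qed.

Lemma denom_gt0 : 0 < denom%:R :> rat.
Proof. by rewrite ltr0n /denom addn1. Qed.

Lemma big_states (F : state -> rat) : \sum_(q <- states) F q =
  F (Root false) + F (Root true) + F (Mix false) + F (Mix true) +
  F (Ini false 0) + F (Ini false 1) + F (Ini false 2) +
  F (Ini true 0) + F (Ini true 1) + F (Ini true 2) +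
  F Fin + F Dead + F (Acc false) + F (Acc true) +
  \sum_(ij <- pairs r) F (Vec false ij.1 ij.2) +
  \sum_(ij <- pairs r) F (Vec true ij.1 ij.2).
Proof. by rewrite !big_cat !big_cons big_nil !big_map /= addr0 !addrA. Qed.

Lemma big_letters (F : letter -> rat) : \sum_(a <- letters) F a =
  F Start + F Expand + F Restart + F Stop + F Draw + \sum_(e <- edges M) F (Cmd e).
Proof. by rewrite big_cat !big_cons big_nil big_map /= addr0 !addrA. Qed.

Lemma control_letters : {subset [:: Start; Expand; Restart; Stop; Draw] <= letters}.
Proof. by move=> a aC; rewrite mem_cat aC. Qed.

Lemma mem_letters_Cmd e : Cmd e \in letters -> e \in edges M.
Proof.
rewrite mem_cat => /orP[|/mapP[f fE [->]] //].
by rewrite !inE => /or4P[/eqP|/eqP|/eqP|/orP[/eqP|/eqP]].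
Qed.

Lemma chain_weight_sum p : ~~ is_fin p ->
  \sum_(q <- states) \sum_(a <- letters) chain_weight a p q = 1.
Proof.
move=> nfin; have [op|np] := boolP (ordinary p).
  under eq_bigr => q _.
    under eq_bigr => a _ do rewrite (chain_weight_ordinary _ _ op).
    over.
  under eq_bigr => q _ do rewrite big_split /= -mulr_suml -natr_sum.
  rewrite big_split /= -mulr_suml -natr_sum -/(row_total p).
  rewrite [X in _ + X](_ : _ = 1 - (row_total p)%:R / scale%:R).
    by rewrite addrC subrK.
  by rewrite big_states !big_letters /slack !(big1_eq, addr0, add0r).
have vec0 c :
    \sum_(ij <- pairs r) \sum_(a <- letters) chain_weight a p (Vec c ij.1 ij.2) = 0.
  rewrite big1 // => ij _; rewrite big_letters.
  by case: p nfin np => //= b _ _; rewrite big1_eq !addr0.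
rewrite big_states !vec0 !big_letters.
have denomE : (x * x)%:R + x%:R + 1 = denom%:R :> rat by rewrite /denom !natrD.
have D0 := lt0r_neq0 denom_gt0; case: p nfin np {vec0} => // -[] _ _ /=;
  rewrite !(big1_eq, addr0, add0r).
- by rewrite -!mulrDl denomE divff.
- by rewrite -!mulrDl denomE divff.
- by rewrite -mulrDl addrC natr1 divff.
- by rewrite -splitr.
Qed.

Lemma row_total_leq_scale p : p \in states -> (row_total p <= scale)%N.
Proof.
rewrite /scale => ps; apply: leqW; elim: states ps => //= p' s IHs.
by rewrite inE big_cons => /predU1P[->|/IHs]; lia.
Qed.

Lemma chain_weight_ge0 a p q : p \in states -> 0 <= chain_weight a p q.
Proof.
move=> ps; have [op|] := boolP (ordinary p).
  rewrite chain_weight_ordinary // addr_ge0 ?divr_ge0 // /slack.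
  case: a => //; case: q => //.
  by rewrite subr_ge0 ler_pdivrMr ?scale_gt0 // mul1r ler_nat row_total_leq_scale.
case: p {ps} => // b _; case: a => //; case: q => // b'.
  by move=> n /=; case: ifP => // _; case: n => [|[|n]]; exact: divr_ge0.
by rewrite /chain_weight /mix_weight; case: b; case: b'; rewrite divr_ge0 ?ler01 ?ler0n.
Qed.

Lemma chain_wf : wf_WA chain.
Proof. by apply: (@automaton_wf _ _ _ _ Dead Start) => *; exact: chain_weight_ge0. Qed.

Lemma chain_LMC : is_LMC chain.
Proof.
apply: (automaton_LMC Dead Start); [exact: chain_weight_ge0|exact: chain_weight_sum|].
by move=> a [].
Qed.

Lemma chain_value_ge0 p w : p \in states -> 0 <= cval p w.
Proof. by apply: value_ge0 => *; exact: chain_weight_ge0. Qed.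

Lemma value_Root_ge0 b w : 0 <= cval (Root b) w.
Proof. by apply: chain_value_ge0; case: b; rewrite !inE ?eqxx ?orbT. Qed.

Lemma value_Fin_ge0 w : 0 <= cval Fin w.
Proof. by apply: chain_value_ge0; rewrite !inE eqxx ?orbT. Qed.

Lemma value_Dead w : cval Dead w = 0.
Proof.
elim: w => // a w IHw; rewrite value_cons big1 // => q _.
rewrite chain_weight_ordinary // (_ : int_weight a Dead q = 0%N); last by case: a.
rewrite mul0r add0r /slack; case: a => *; rewrite ?mul0r //.
by case: q => *; rewrite ?mul0r ?IHw ?mulr0.
Qed.

Lemma value_ordinary a p w : ordinary p ->
  cval p (a :: w) = (\sum_(q <- states) (int_weight a p q)%:R * cval q w) / scale%:R.
Proof.
move=> op; rewrite value_cons mulr_suml.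
under eq_bigr => q _ do rewrite (chain_weight_ordinary _ _ op).
apply: eq_bigr => q _; rewrite mulrDl mulrAC -[RHS]addr0; congr (_ + _).
case: a => [||||| ?]; rewrite ?mul0r //.
by case: q => [?|?|? ?|||?|? ? ?]; rewrite ?mul0r // value_Dead mulr0.
Qed.

Lemma value_sparse a p (f : rat) w : ordinary p ->
  \sum_(q <- states) (int_weight a p q)%:R * cval q w = f ->
  cval p (a :: w) = f / scale%:R.
Proof. by move=> op <-; exact: value_ordinary. Qed.

Lemma sum_mul0 (F : nat * nat -> rat) : \sum_(ij <- pairs r) 0%:R * F ij = 0.
Proof. by rewrite big1 // => ij _; rewrite mul0r. Qed.

Lemma value_Acc_Restart b w : cval (Acc b) (Restart :: w) = cval (Root b) w / scale%:R.
Proof.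
apply: value_sparse => //; rewrite big_states /= !sum_mul0.
by case: b; rewrite !mul0r mul1r !addr0 ?add0r.
Qed.

Lemma value_Acc_Stop b w : cval (Acc b) (Stop :: w) = cval Fin w / scale%:R.
Proof.
apply: value_sparse => //.
by rewrite big_states /= !sum_mul0 !mul0r mul1r !addr0 ?add0r.
Qed.

Lemma value_Acc_Cmd b e w : cval (Acc b) (Cmd e :: w) = cval (Acc b) w / scale%:R.
Proof.
apply: value_sparse => //; rewrite big_states /= !sum_mul0.
by case: b; rewrite !mul0r mul1r !addr0 ?add0r.
Qed.

Lemma value_Vec_Restart b i j w : cval (Vec b i j) (Restart :: w) =
  (final_coef b i j)%:R * cval (Root b) w / scale%:R.
Proof.
apply: value_sparse => //; rewrite big_states /= !sum_mul0.
by case: b; rewrite !mul0n mul1n !mul0r !addr0 ?add0r.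
Qed.

Lemma value_Vec_Stop b i j w : cval (Vec b i j) (Stop :: w) =
  (final_coef b i j)%:R * cval Fin w / scale%:R.
Proof.
by apply: value_sparse => //; rewrite big_states /= !sum_mul0 !mul0r !addr0 ?add0r.
Qed.

Lemma value_Vec_Cmd b i j e w : cval (Vec b i j) (Cmd e :: w) =
  ((cost_coef b (tests e) i j)%:R * cval (Acc b) w +
   \sum_(kl <- pairs r) (count_mem i (update e kl.1) * count_mem j (update e kl.2))%:R *
      cval (Vec b kl.1 kl.2) w) / scale%:R.
Proof.
apply: value_sparse => //; rewrite big_states /=.
case: b; rewrite !mul0n mul1n ?sum_mul0 !mul0r !addr0 ?add0r; congr (_ + _);
  by apply: eq_bigr => kl _; rewrite mul1n.
Qed.

Lemma value_Ini b n w : cval (Ini b n) (Expand :: w) =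
  (\sum_(ij <- pairs r) (initial_coef n ij.1 ij.2)%:R * cval (Vec b ij.1 ij.2) w) /
    scale%:R.
Proof.
apply: value_sparse => //; rewrite big_states /= value_Dead mulr0.
case: b; rewrite !mul0r !sum_mul0 !addr0 ?add0r;
  by apply: eq_bigr => ij _; rewrite mul1n.
Qed.

Lemma value_Ini0 b n a w : a != Expand -> cval (Ini b n) (a :: w) = 0.
Proof.
move=> an; rewrite (@value_sparse _ _ 0) ?mul0r // big1 // => q _.
by case: a an => [|/eqP|||| e] //= *; rewrite mul0r.
Qed.

Lemma value_Root_Start b w : cval (Root b) (Start :: w) =
  start_weight 0 * cval (Ini b 0) w + start_weight 1 * cval (Ini b 1) w +
  start_weight 2 * cval (Ini b 2) w.
Proof.
rewrite [LHS]/= big_states !big1 => [|ij _|ij _]; [|exact: mul0r|exact: mul0r].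
by case: b; rewrite [LHS]/= !mul0r !addr0 !add0r.
Qed.

Lemma value_Root0 b a w : a != Start -> cval (Root b) (a :: w) = 0.
Proof.
move=> an; rewrite /= big1 // => q _.
by case: a an => [/eqP||||| e] //= *; rewrite mul0r.
Qed.

Lemma value_Root_Start0 b a w : a != Expand -> cval (Root b) [:: Start, a & w] = 0.
Proof. by move=> an; rewrite value_Root_Start !value_Ini0 // !mulr0 !addr0. Qed.

Lemma value_Mix b w : cval (Mix b) (Draw :: w) =
  mix_weight b false * cval (Root false) w + mix_weight b true * cval (Root true) w.
Proof.
rewrite [LHS]/= big_states !big1 => [|ij _|ij _]; [|exact: mul0r|exact: mul0r].
by rewrite !mul0r !addr0.
Qed.

Lemma value_Mix0 b a w : a != Draw -> cval (Mix b) (a :: w) = 0.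
Proof.
move=> an; rewrite /= big1 // => q _.
by case: a an => [||||/eqP| e] //= *; rewrite mul0r.
Qed.

(* The value of [w] from the vector of a run whose variables are [v] and whose
   accumulated cost is [acc]. *)
Definition run_value (b : bool) (v : nat -> nat) (acc : nat) (w : seq letter) : rat :=
  acc%:R * cval (Acc b) w +
  \sum_(ij <- pairs r) (v ij.1 * v ij.2)%:R * cval (Vec b ij.1 ij.2) w.

Lemma run_value_nil b v acc : run_value b v acc [::] = 0.
Proof. by rewrite /run_value big1 ?mulr0 ?addr0 // => ij _; rewrite mulr0. Qed.

Lemma run_value0 b v acc a w : a \in [:: Start; Expand; Draw] ->
  run_value b v acc (a :: w) = 0.
Proof.
move=> an; have value0 p : ordinary p -> (forall q, int_weight a p q = 0%N) ->
    cval p (a :: w) = 0.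
  move=> op pq0; rewrite (@value_sparse _ _ 0) ?mul0r // big1 // => q _.
  by rewrite pq0 mul0r.
have no_exit p q : (if p is Ini _ _ then false else true) -> int_weight a p q = 0%N.
  by move: an; rewrite !inE => /or3P[] /eqP ->; case: p.
rewrite /run_value value0 // => [|q]; last exact: no_exit.
rewrite mulr0 add0r big1 // => ij _; rewrite value0 ?mulr0 // => q; exact: no_exit.
Qed.

Lemma final_costE b v : final_cost b v =
  (\sum_(ij <- pairs r) v ij.1 * v ij.2 * final_coef b ij.1 ij.2)%N.
Proof.
rewrite /final_cost (@costE r) => [|t]; last first.
  by rewrite inE => /eqP ->; exact: position_test_bound.
under [RHS]eq_bigr => ij _ do rewrite mulnDr.
have r1 : (1 < r)%N := ltnW (dimension_gt2 _).
rewrite big_split; congr (_ + _)%N; rewrite big_allpairs /=.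
rewrite (bigD1_seq 1%N) ?iota_uniq ?mem_iota //=.
rewrite (bigD1_seq 1%N) ?iota_uniq ?mem_iota //=.
rewrite !big1 ?addn0 ?mulnA; first by case: b => /=; lia.
  by move=> i /negPf i1; rewrite big1 // => j _; rewrite i1 andbF muln0.
by move=> i /negPf i1; rewrite i1 !andbF muln0.
Qed.

Lemma sum_products (F : nat -> nat -> nat) (v : nat -> nat) (y c : rat) :
  \sum_(ij <- pairs r) (v ij.1 * v ij.2)%:R * ((F ij.1 ij.2)%:R * y / c) =
  (\sum_(ij <- pairs r) v ij.1 * v ij.2 * F ij.1 ij.2)%N%:R * y / c.
Proof.
rewrite natr_sum !mulr_suml; apply: eq_bigr => ij _.
by rewrite !natrM !mulrA.
Qed.

Lemma run_value_Restart b v acc w : run_value b v acc (Restart :: w) =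
  (acc + final_cost b v)%:R * cval (Root b) w / scale%:R.
Proof.
rewrite /run_value value_Acc_Restart.
under eq_bigr => ij _ do rewrite value_Vec_Restart.
by rewrite sum_products -final_costE natrD mulrDl mulrDl mulrA.
Qed.

Lemma run_value_Stop b v acc w : run_value b v acc (Stop :: w) =
  (acc + final_cost b v)%:R * cval Fin w / scale%:R.
Proof.
rewrite /run_value value_Acc_Stop.
under eq_bigr => ij _ do rewrite value_Vec_Stop.
by rewrite sum_products -final_costE natrD mulrDl mulrDl mulrA.
Qed.

Lemma run_value_Cmd b v acc e w : e \in edges M ->
  run_value b v acc (Cmd e :: w) =
  run_value b (advance e v) (acc + cost b (tests e) v) w / scale%:R.
Proof.
move=> eE; rewrite /run_value value_Acc_Cmd.
under eq_bigr => ij _ do rewrite value_Vec_Cmd mulrDl mulrDr.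
rewrite big_split /= sum_products -costE => [|t]; last exact: tests_bound.
rewrite addrA mulrA -mulrDl -mulrDl -natrD mulrDl; congr (_ + _).
rewrite mulr_suml; under eq_bigr => ij _ do rewrite mulr_suml mulr_sumr.
rewrite exchange_big; apply: eq_big_seq => -[k l]; rewrite mem_pairs => /andP[kr lr] /=.
rewrite /advance (@lval_mul r) ?update_bound // natr_sum !mulr_suml.
by apply: eq_bigr => ij _; rewrite !natrM !mulrA.
Qed.

Lemma initial_vars_mul i j : (initial_vars i * initial_vars j)%N =
  (x * x * initial_coef 0 i j + x * initial_coef 1 i j + initial_coef 2 i j)%N.
Proof.
have varsE k : initial_vars k = (x * (k == 2) + snapshot (entry M) (stack [::]) k)%N.
  by case: k => [|[|[|[|k]]]]; rewrite /initial_vars /stack /=; lia.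
by rewrite !varsE /initial_coef; lia.
Qed.

Lemma value_Root_Start_Expand b w : cval (Root b) [:: Start, Expand & w] =
  run_value b initial_vars 0 w / (denom%:R * scale%:R).
Proof.
rewrite value_Root_Start !value_Ini /run_value mul0r add0r /start_weight.
set S := fun n =>
  \sum_(ij <- pairs r) (initial_coef n ij.1 ij.2)%:R * cval (Vec b ij.1 ij.2) w.
rewrite [X in _ = X / _](_ : _ = (x * x)%:R * S 0%N + x%:R * S 1%N + S 2).
  rewrite -/(S 0%N) -/(S 1%N) -/(S 2); field.
  by rewrite !lt0r_neq0 ?denom_gt0 ?scale_gt0.
rewrite /S !mulr_sumr -!big_split /=; apply: eq_bigr => ij _.
rewrite initial_vars_mul.
move: (initial_coef 0) (initial_coef 1) (initial_coef 2) => c0 c1 c2.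
by rewrite !natrD !natrM; ring.
Qed.

(* Either some test has already failed, or the run is so far correct. *)
Definition run_invariant (v : nat -> nat) (acc acc' : nat) : Prop :=
  v 1%N = 1%N /\ ((acc < acc')%N \/ acc = acc' /\ exists p s,
    v = snapshot p s /\ reaches (edges M) (entry M, stack [:: x]) (p, s)).

Lemma run_invariant_initial : run_invariant initial_vars 0 0.
Proof.
split=> //; right; split=> //; exists (entry M), (stack [:: x]); split=> //.
exact: rt_refl.
Qed.

Lemma run_invariant_advance v acc acc' e : e \in edges M -> run_invariant v acc acc' ->
  run_invariant (advance e v)
    (acc + cost false (tests e) v) (acc' + cost true (tests e) v).
Proof.
move=> eE [v1 inv]; split; first by rewrite advance_one.
case: inv => [lt|[-> [p [s [-> run]]]]].
  by left; have := cost_leq (tests e) v; lia.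
have [ok|/cost_lt lt] := boolP (passes (tests e) (snapshot p s)); last first.
  by left; rewrite ltn_add2l.
right; rewrite cost_eq //; split=> //.
case: e eE ok => -[q c] q' eE /passes_tests[pq [t st]]; subst q.
exists q', t; rewrite (advance_snapshot _ _ _ st); split=> //.
by apply: rt_trans run (rt_step _ _ _ _ _); exists c.
Qed.

Lemma final_cost_true v : final_cost true v = cost true [:: position_test (exit M)] v.
Proof. exact: addn0. Qed.

Lemma final_cost_false v : v 1%N = 1%N ->
  final_cost false v = (cost false [:: position_test (exit M)] v).+1.
Proof. by move=> v1; rewrite /final_cost v1 addn1. Qed.

Lemma run_invariant_final v acc acc' : ~ halts_on M x -> run_invariant v acc acc' ->
  (acc + final_cost false v <= acc' + final_cost true v)%N.
Proof.
move=> nohalt [v1 inv]; rewrite final_cost_true final_cost_false //.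
case: inv => [lt|[-> [p [s [-> run]]]]].
  by have := cost_leq [:: position_test (exit M)] v; lia.
rewrite leq_add2l; apply: cost_lt; rewrite passes_position.
by apply/eqP => pf; subst p; apply: nohalt; exists s.
Qed.

Lemma run_value_leq n v acc acc' w : ~ halts_on M x ->
  (forall w', (size w' < n)%N -> {subset w' <= letters} ->
     cval (Root false) w' <= cval (Root true) w') ->
  (size w <= n)%N -> {subset w <= letters} -> run_invariant v acc acc' ->
  run_value false v acc w <= run_value true v acc' w.
Proof.
move=> nohalt le_root; elim: w v acc acc' => [|a w IHw] v acc acc' wn wL inv.
  by rewrite !run_value_nil.
have w'L : {subset w <= letters} by move=> b bw; apply: wL; rewrite inE bw orbT.
have scale_inv_ge0 : 0 <= scale%:R^-1 :> rat by rewrite invr_ge0.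
have := wL a (mem_head _ _); case: a wn {wL} => [||||| e] wn.
- by rewrite !run_value0 ?inE ?eqxx ?orbT.
- by rewrite !run_value0 ?inE ?eqxx ?orbT.
- rewrite !run_value_Restart ler_wpM2r //.
  by apply: ler_pM; rewrite ?value_Root_ge0 ?ler_nat ?run_invariant_final ?le_root.
- rewrite !run_value_Stop ler_wpM2r // ler_wpM2r ?value_Fin_ge0 //.
  by rewrite ler_nat run_invariant_final.
- by rewrite !run_value0 ?inE ?eqxx ?orbT.
- move=> /mem_letters_Cmd eE; rewrite !run_value_Cmd // ler_wpM2r // IHw //.
    exact: ltnW.
  exact: run_invariant_advance.
Qed.

Lemma diverging_value_Root w : ~ halts_on M x -> {subset w <= letters} ->
  cval (Root false) w <= cval (Root true) w.
Proof.
move=> nohalt; have [n] := ubnP (size w); elim: n w => // n IHn [//|a w] wn wL.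
have [->|an] := eqVneq a Start; last by rewrite !value_Root0.
case: w wn wL => [|b w] wn wL; first by rewrite !value_Root_Start /= !mulr0.
have [->|bn] := eqVneq b Expand; last by rewrite !value_Root_Start0.
rewrite !value_Root_Start_Expand ler_wpM2r ?invr_ge0 ?mulr_ge0 ?ler0n //.
apply: (run_value_leq (n := n)) => //; last exact: run_invariant_initial.
  by move: wn => /=; lia.
by move=> c cw; apply: wL; rewrite !inE cw !orbT.
Qed.

Lemma reaches_word y z : reaches (edges M) y z ->
  exists u G, {subset u <= letters} /\ forall b acc w,
    run_value b (snapshot y.1 y.2) acc (u ++ w) =
    run_value b (snapshot z.1 z.2) (acc + G) w / scale%:R ^+ size u.
Proof.
elim/clos_refl_trans_ind_right=> [|[p s] [q t] [c eE st] [u [G [uL IH]]] _].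
  by exists [::], 0%N; split=> // b acc w; rewrite addn0 expr0 divr1.
pose e := (p, c, q).
exists (Cmd e :: u), (cost false (tests e) (snapshot p s) + G)%N; split=> [a|b acc w].
  by rewrite inE => /predU1P[->|/uL//]; rewrite mem_cat map_f ?orbT.
rewrite /= run_value_Cmd // (advance_snapshot _ _ _ st) IH addnA exprSr invfM mulrA.
have pass : passes (tests e) (snapshot p s) by apply/passes_tests; split=> //; exists t.
by case: b => //; rewrite cost_eq.
Qed.

Lemma halting_block : halts_on M x -> exists u c F,
  [/\ 0 < c, {subset u <= letters},
      forall b w, cval (Root b) (u ++ Restart :: w) =
        c * (F + ~~ b)%:R * cval (Root b) w &
      forall b, cval (Root b) (u ++ [:: Stop]) = c * (F + ~~ b)%:R].
Proof.
move=> [t /reaches_word[u [G [uL uE]]]].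
pose F := (G + final_cost true (snapshot (exit M) t))%N.
have finalF b : (0 + G + final_cost b (snapshot (exit M) t) = F + ~~ b)%N.
  rewrite /F add0n; case: b; first by rewrite addn0.
  by rewrite final_cost_true final_cost_false // addn1 addnS cost_eq ?passes_position.
have [s_gt0 d_gt0] := (scale_gt0, denom_gt0).
exists [:: Start, Expand & u].
exists ((scale%:R ^+ size u)^-1 / scale%:R / (denom%:R * scale%:R)), F.
split=> [|a|b w|b].
- by rewrite !(divr_gt0, mulr_gt0, invr_gt0, exprn_gt0).
- move=> /predU1P[->|/predU1P[->|/uL //]];
    by rewrite control_letters // !inE eqxx ?orbT.
- rewrite value_Root_Start_Expand uE run_value_Restart finalF; field.
  by rewrite expf_neq0 ?lt0r_neq0.
- rewrite value_Root_Start_Expand uE run_value_Stop finalF /=; field.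
  by rewrite expf_neq0 ?lt0r_neq0.
Qed.

Lemma halting_value_Root K : halts_on M x ->
  exists2 w, {subset w <= letters} & K%:R * cval (Root true) w < cval (Root false) w.
Proof.
move=> /halting_block[u [c [F [c_gt0 uL restart stop]]]].
pose blocks m := iter m (fun w => u ++ Restart :: w) (u ++ [:: Stop]).
have blocksE b m : cval (Root b) (blocks m) = c ^+ m.+1 * ((F + ~~ b) ^ m.+1)%:R.
  elim: m => [|m IHm]; first by rewrite expr1 expn1 stop.
  by rewrite restart IHm mulrACA -natrM -exprS -expnS.
have [m lt_m] := exp_succ_gap F K; exists (blocks m).
  have cat_sub (L : {pred letter}) a w : {subset u <= L} -> a \in L ->
      {subset w <= L} -> {subset u ++ a :: w <= L}.
    by move=> sub_u aL sub_w l; rewrite mem_cat => /orP[/sub_u|/predU1P[->|/sub_w]].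
  by elim: m {lt_m} => [|m IHm]; apply: cat_sub => //;
    rewrite control_letters // !inE eqxx ?orbT.
rewrite !blocksE /= mulrCA ltr_pM2l ?exprn_gt0 // addn0 addn1 -natrM ltr_nat.
exact: lt_m.
Qed.

End Chain.

(** * Distances in the chain *)

(* The positions of [Root b] and [Mix b] in [states]. *)
Definition root_index (b : bool) : nat := b.
Definition mix_index (b : bool) : nat := b.+2.

Section ChainDistances.
Variables (M : flowchart) (x : nat) (R : realType).
Local Notation A := (chain M x).
Local Notation cval := (value (states M) (chain_weight M x) is_fin).
Local Open Scope ring_scope.

Lemma size_states_gt13 : (13 < size (states M))%N.
Proof. by rewrite /states size_cat. Qed.

Lemma chain_states_ok s s' : (s <= 13)%N -> (s' <= 13)%N -> states_ok A s s'.
Proof. by move=> ls ls'; split; exact: leq_ltn_trans size_states_gt13. Qed.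

Lemma nu_root b (w : word A) :
  nu R (root_index b) w = ratr (cval (Root b) (spell Start w)).
Proof.
by case: b; rewrite (nu_automaton Dead Start) //; apply: leq_ltn_trans size_states_gt13.
Qed.

Lemma nu_mix b (w : word A) :
  nu R (mix_index b) w = ratr (cval (Mix b) (spell Start w)).
Proof.
by case: b; rewrite (nu_automaton Dead Start) //; apply: leq_ltn_trans size_states_gt13.
Qed.

Lemma chain_word lw : {subset lw <= letters M} -> exists w : word A, spell Start w = lw.
Proof. exact: spell_surj. Qed.

Lemma nu_chain_ge0 s (w : word A) : 0 <= nu R s w.
Proof. exact/nu_ge0/chain_wf. Qed.

Lemma diverging_big_O :
  ~ halts_on M x -> big_O R A (root_index false) (root_index true).
Proof.
move=> nohalt; exists 1; split=> // w.
rewrite mul1r !nu_root ler_rat diverging_value_Root // => a; exact: spell_letters.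
Qed.

Lemma halting_not_big_O :
  halts_on M x -> ~ big_O R A (root_index false) (root_index true).
Proof.
move=> halts [C [C_gt0 leC]].
have [_ /chain_word[w <-]] := halting_value_Root (Num.bound C) halts.
rewrite -(ltr_rat R) rmorphM /= ratr_nat -!nu_root ltNge => /negP[].
apply: le_trans (leC w) _; apply: ler_wpM2r; first exact: nu_chain_ge0.
exact/ltW/archi_boundP/ltW.
Qed.

Lemma value_MixP w : (forall b, cval (Mix b) w = 0) \/ exists2 w', w = Draw :: w' &
  forall b, cval (Mix b) w =
    mix_weight b false * cval (Root false) w' + mix_weight b true * cval (Root true) w'.
Proof.
case: w => [|a w]; first by left.
have [->|an] := eqVneq a Draw; last by left=> b; exact: value_Mix0.
by right; exists w => // b; exact: value_Mix.
Qed.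

Lemma value_Mix_false_leq w : cval (Mix false) w <= 16 * cval (Mix true) w.
Proof.
have [zero|[w' _ mixE]] := value_MixP w; first by rewrite !zero mulr0.
have := value_Root_ge0 M x false w'; have := value_Root_ge0 M x true w'.
by rewrite !mixE /mix_weight; lra.
Qed.

Lemma value_Mix_true_leq w : cval (Mix true) w <= 2 * cval (Mix false) w.
Proof.
have [zero|[w' _ mixE]] := value_MixP w; first by rewrite !zero mulr0.
have := value_Root_ge0 M x false w'; have := value_Root_ge0 M x true w'.
by rewrite !mixE /mix_weight; lra.
Qed.

Lemma diverging_value_Mix w : ~ halts_on M x -> {subset w <= letters M} ->
  cval (Mix false) w <= 2 * cval (Mix true) w.
Proof.
move=> nohalt; have [zero|[w' -> mixE]] := value_MixP w; first by rewrite !zero mulr0.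
move=> wL; have : cval (Root false) w' <= cval (Root true) w'.
  by apply: diverging_value_Root => // a aw; apply: wL; rewrite inE aw orbT.
have := value_Root_ge0 M x false w'; have := value_Root_ge0 M x true w'.
by rewrite !mixE /mix_weight; lra.
Qed.

Lemma halting_value_Mix : halts_on M x -> exists2 w, {subset w <= letters M} &
  0 < cval (Mix true) w /\ 8 * cval (Mix true) w <= cval (Mix false) w.
Proof.
move=> /(halting_value_Root 29)[w wL gap]; exists (Draw :: w).
  by move=> a /predU1P[->|/wL //]; rewrite control_letters // !inE eqxx ?orbT.
have := value_Root_ge0 M x true w; move: gap; rewrite !value_Mix /mix_weight.
by split; lra.
Qed.

Section Distance.
Variable d : WA -> nat -> nat -> \bar R.
Hypothesis tvx_le_d : forall A s s', (tvx R A s s' <= d A s s')%E.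
Hypothesis d_le_tvx_sym : forall A s s', (d A s s' <= tvx_sym R A s s')%E.

Lemma dist_le (K : rat) : 2 <= K ->
  (forall w, {subset w <= letters M} -> cval (Mix false) w <= K * cval (Mix true) w) ->
  (d A (mix_index false) (mix_index true) <= (ratr K)%:E)%E.
Proof.
move=> K2 leK; have K0 : 0 <= ratr K :> R by rewrite ler0q; lra.
apply: le_trans (d_le_tvx_sym _ _ _) _; rewrite ge_max; apply/andP; split;
  apply: tvx_le => // [|w]; try exact: chain_wf; rewrite !nu_mix -rmorphM ler_rat.
  by apply: leK => a; exact: spell_letters.
apply: le_trans (value_Mix_true_leq _) _; apply: ler_wpM2r => //.
by apply: chain_value_ge0; rewrite !inE eqxx ?orbT.
Qed.

Lemma dist_le16 : (d A (mix_index false) (mix_index true) <= 16%:E)%E.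
Proof.
rewrite -[16](ratr_nat R); apply: dist_le => [|w _]; first by lra.
exact: value_Mix_false_leq.
Qed.

Lemma diverging_dist_le2 :
  ~ halts_on M x -> (d A (mix_index false) (mix_index true) <= 2%:E)%E.
Proof.
move=> nohalt; rewrite -[2](ratr_nat R); apply: dist_le => [//|w wL].
exact: diverging_value_Mix.
Qed.

Lemma halting_dist_ge8 :
  halts_on M x -> (8%:E <= d A (mix_index false) (mix_index true))%E.
Proof.
move=> /halting_value_Mix[_ /chain_word[w <-]].
rewrite -(ltr0q R) -(ler_rat R) rmorphM /= ratr_nat -!nu_mix => -[w0 le8].
by apply: le_trans (tvx_le_d _ _ _); apply: tvx_ge le8 => //; exact: chain_wf.
Qed.

Lemma dist_ge0 : (0 <= d A (mix_index false) (mix_index true))%E.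
Proof. exact: le_trans (tvx_ge0 _ _ _ _) (tvx_le_d _ _ _). Qed.

Lemma dist_bounded_promise t : bounded_promise d (A, mix_index false, mix_index true, t).
Proof.
split; first exact: chain_LMC.
split; first exact: chain_states_ok.
exact: le_lt_trans dist_le16 (ltry _).
Qed.

Lemma fine_dist_gap : let t := fine (d A (mix_index false) (mix_index true)) in
  [/\ 0 <= t, halts_on M x -> 8 <= t & ~ halts_on M x -> t <= 2].
Proof.
have := dist_ge0; have := dist_le16.
have := halting_dist_ge8; have := diverging_dist_le2.
by case: (d _ _ _).
Qed.

End Distance.
End ChainDistances.

(** * Arithmetic on codes *)

Definition cConst (n : nat) : code := iter n (cComp cSucc) cZero.

Lemma eval_cConst n x : eval (cConst n) x n.
Proof. by elim: n => [|n IHn]; [constructor | apply: evComp IHn _; constructor]. Qed.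

Definition cPred (f : code) : code :=
  cComp (cRec cZero (cComp cFst cSnd)) (cPair cZero f).

Lemma eval_cPred f x a : eval f x a -> eval (cPred f) x a.-1.
Proof.
move=> fa; apply: evComp; first by apply: evPair fa; constructor.
elim: a {fa} => [|a IHa]; first by do 2 constructor.
by apply: evRecS IHa _; apply: evComp; constructor.
Qed.

Definition cId : code := cPred cSucc.

Lemma eval_cId x : eval cId x x.
Proof. exact: (eval_cPred (evSucc x)). Qed.

Definition cAdd (f g : code) : code :=
  cComp (cRec cId (cComp cSucc (cComp cSnd cSnd))) (cPair f g).

Lemma eval_cAdd f g x a b : eval f x a -> eval g x b -> eval (cAdd f g) x (a + b).
Proof.
move=> fa gb; apply: evComp; first exact: evPair fa gb.
elim: b {gb} => [|b IHb]; first by rewrite addn0; apply/evRec0/eval_cId.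
by rewrite addnS; apply: evRecS IHb _; do !apply: evComp; constructor.
Qed.

Definition cDouble (f : code) : code := cAdd f f.

Lemma eval_cDouble f x a : eval f x a -> eval (cDouble f) x a.*2.
Proof. by move=> fa; rewrite -addnn; exact: eval_cAdd. Qed.

Definition cMul (f g : code) : code :=
  cComp (cRec cZero (cAdd (cComp cSnd cSnd) cFst)) (cPair f g).

Lemma eval_cMul f g x a b : eval f x a -> eval g x b -> eval (cMul f g) x (a * b).
Proof.
move=> fa gb; apply: evComp; first exact: evPair fa gb.
elim: b {gb} => [|b IHb]; first by rewrite muln0; do 2 constructor.
rewrite mulnS addnC; apply: evRecS IHb _; apply: eval_cAdd; last by constructor.
by apply: evComp; constructor.
Qed.

Definition cSub (f g : code) : code :=
  cComp (cRec cId (cPred (cComp cSnd cSnd))) (cPair f g).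

Lemma eval_cSub f g x a b : eval f x a -> eval g x b -> eval (cSub f g) x (a - b).
Proof.
move=> fa gb; apply: evComp; first exact: evPair fa gb.
elim: b {gb} => [|b IHb]; first by rewrite subn0; apply/evRec0/eval_cId.
by rewrite subnS; apply: evRecS IHb _; apply: eval_cPred; apply: evComp; constructor.
Qed.

Definition cDrop (i : nat) (f : code) : code := iter i (fun g => cComp g cSnd) f.

Lemma eval_cDropS i f a b c : eval (cDrop i f) b c -> eval (cDrop i.+1 f) (cpair a b) c.
Proof. by move=> fb; apply: evComp fb; constructor. Qed.

Definition prepend (s : seq nat) (t : nat) : nat :=
  foldr (fun a b => (cpair a b).+1) t s.

Definition cPrepend (fs : seq code) (g : code) : code :=
  foldr (fun f h => cComp cSucc (cPair f h)) g fs.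

Lemma eval_cPrepend x fs g s t : List.Forall2 (fun f a => eval f x a) fs s ->
  eval g x t -> eval (cPrepend fs g) x (prepend s t).
Proof.
move=> fs_s gt; elim: fs_s => //= f a {}fs {}s fa _ IH.
by apply: evComp; [exact: evPair fa IH | constructor].
Qed.

Lemma enc_rat_coprime (n d : nat) : coprime n d -> 0 < d ->
  enc_rat (n%:R / d%:R)%R = cpair n.*2 d.*2.
Proof.
move=> nd d0; have nd' : coprime `|Posz n| `|Posz d| by [].
rewrite /enc_rat !pmulrn coprimeq_num // coprimeq_den //.
case: d d0 {nd nd'} => // d _.
by rewrite gtr0_sg // mul1r.
Qed.

Definition cRat0 : code := cPair cZero (cConst 2).

Lemma eval_cRat0 x : eval cRat0 x (enc_rat 0).
Proof.
by have -> : enc_rat 0 = cpair 0 2 by []; exact: evPair (evZero _) (eval_cConst _ _).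
Qed.

Definition cDenom : code := cAdd (cAdd (cMul cId cId) cId) (cConst 1).

Lemma eval_cDenom x : eval cDenom x (denom x).
Proof.
apply: eval_cAdd (eval_cConst _ _); apply: eval_cAdd (eval_cId _).
by apply: eval_cMul; exact: eval_cId.
Qed.

Lemma coprime_denom x : coprime x (denom x).
Proof.
have -> : denom x = x.+1 * x + 1 by rewrite /denom; lia.
by rewrite /coprime gcdnMDl gcdn1.
Qed.

Definition cStartWeight (n : nat) : code :=
  cPair (cDouble (match n with 0 => cMul cId cId | 1 => cId | _ => cConst 1 end))
        (cDouble cDenom).

Lemma eval_cStartWeight n x : eval (cStartWeight n) x (enc_rat (start_weight x n)).
Proof.
have d_gt0 : 0 < denom x by rewrite /denom addn1.
have cop := coprime_denom x; have evx := eval_cId x.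
case: n => [|[|n]].
- rewrite enc_rat_coprime ?coprimeMl ?cop //.
  by apply: evPair; apply: eval_cDouble; [exact: eval_cMul | exact: eval_cDenom].
- rewrite enc_rat_coprime //.
  by apply: evPair; apply: eval_cDouble; [exact: evx | exact: eval_cDenom].
- rewrite -[start_weight x n.+2]/(1%:R / (denom x)%:R)%R enc_rat_coprime ?coprime1n //.
  by apply: evPair; apply: eval_cDouble; [exact: eval_cConst | exact: eval_cDenom].
Qed.

(** * The encoding of the chain as a function of the input *)

Section Template.
Variable M : flowchart.
Local Notation row x a p := [seq chain_weight M x a p q | q <- states M].
Local Notation size_pairs := (size (pairs (dimension (edges M)))).

Definition is_root (p : state) : bool := if p is Root _ then true else false.

Definition is_start (a : letter) : bool := if a is Start then true else false.

Lemma chain_weight_input_irrelevant x a p q : ~~ (is_start a && is_root p) ->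
  chain_weight M x a p q = chain_weight M 0 a p q.
Proof. by case: p => // b; case: a. Qed.

Lemma row_Root x b : row x Start (Root b) =
  nseq (if b then 7 else 4) 0%R ++ [seq start_weight x n | n <- iota 0 3] ++
  nseq ((if b then 4 else 7) + (size_pairs + size_pairs)) 0%R.
Proof.
have row_Vec c : map (chain_weight M x Start (Root b)) (vecs M c) = nseq size_pairs 0%R.
  by rewrite /vecs; elim: (pairs _) => //= ij s ->.
by rewrite /states !map_cat !row_Vec !nseqD; case: b {row_Vec}.
Qed.

Lemma drop_states_not_root p : p \in drop 2 (states M) -> ~~ is_root p.
Proof.
by move: p; apply/allP; rewrite /= all_cat !all_map; apply/andP; split; exact/allP.
Qed.

Lemma behead_letters_not_start a : a \in behead (letters M) -> ~~ is_start a.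
Proof. by move: a; apply/allP; rewrite /= all_map; exact/allP. Qed.

Lemma wa_M_template : exists rows mats, forall x, wa_M (chain M x) =
  [:: [:: row x Start (Root false), row x Start (Root true) & rows] & mats].
Proof.
exists [seq row 0 Start p | p <- drop 2 (states M)].
exists [seq [seq row 0 a p | p <- states M] | a <- behead (letters M)] => x.
have row0 a p : ~~ (is_start a && is_root p) -> row x a p = row 0 a p.
  by move=> ap; apply: eq_map => q; exact: chain_weight_input_irrelevant.
transitivity ([seq row x Start p | p <- states M] ::
    [seq [seq row x a p | p <- states M] | a <- behead (letters M)]); first by [].
congr (_ :: _); last first.
  apply/eq_in_map => a /behead_letters_not_start not_start; apply: eq_map => p.
  by apply: row0; rewrite (negPf not_start).
transitivity [:: row x Start (Root false), row x Start (Root true) &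
    [seq row x Start p | p <- drop 2 (states M)]]; first by [].
congr [:: _, _ & _]; apply/eq_in_map => p /drop_states_not_root np.
exact: (row0 Start).
Qed.

(* The numbers [n], ..., [F] are the parts of the encoding that do not depend
   on the input of the simulated machine. *)
Definition fill (n k tail0 tail1 rows mats F x : nat) : nat :=
  let starts := [seq enc_rat (start_weight x i) | i <- iota 0 3] in
  let root_row m tail := prepend (nseq m (enc_rat 0) ++ starts) tail in
  cpair n (cpair k (cpair
    (prepend [:: prepend [:: root_row 4 tail0; root_row 7 tail1] rows] mats) F)).

Lemma chain_template : exists n k tail0 tail1 rows mats F, forall x,
  enc_WA (chain M x) = fill n k tail0 tail1 rows mats F x.
Proof.
have [rows [mats ME]] := wa_M_template.
pose tail n := enc_list enc_rat (nseq (n + (size_pairs + size_pairs)) 0%R).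
exists (size (states M)), (size (letters M)), (tail 7), (tail 4).
exists (enc_list (enc_list enc_rat) rows).
exists (enc_list (enc_list (enc_list enc_rat)) mats).
exists (enc_list nat_of_bool (map is_fin (states M))) => x.
by rewrite /enc_WA ME !row_Root.
Qed.

End Template.

Definition cFill : code :=
  let root_row m tail := cPrepend
    (nseq m cRat0 ++ [seq cStartWeight i | i <- iota 0 3]) tail in
  cPair cFst (cPair (cDrop 1 cFst) (cPair
    (cPrepend [:: cPrepend [:: root_row 4 (cDrop 2 cFst); root_row 7 (cDrop 3 cFst)]
                    (cDrop 4 cFst)] (cDrop 5 cFst)) (cDrop 6 cId))).

Lemma eval_cFill n k tail0 tail1 rows mats F :
  let x := cpair n (cpair k (cpair tail0 (cpair tail1 (cpair rows (cpair mats F))))) in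
  eval cFill x (fill n k tail0 tail1 rows mats F x).
Proof.
move=> x; have eval_row m f t : eval f x t ->
    eval (cPrepend (nseq m cRat0 ++ map cStartWeight (iota 0 3)) f) x
      (prepend (nseq m (enc_rat 0) ++
                [seq enc_rat (start_weight x i) | i <- iota 0 3]) t).
  apply: eval_cPrepend; elim: m => [|m IHm]; last first.
    by apply: List.Forall2_cons IHm; exact: eval_cRat0.
  elim: (iota 0 3) => [|i s IHs] /=; first exact: List.Forall2_nil.
  by apply: List.Forall2_cons => //; exact: eval_cStartWeight.
apply: evPair; first exact: evFst.
apply: evPair; first by apply: eval_cDropS; exact: evFst.
apply: evPair; last by do 6!apply: eval_cDropS; exact: eval_cId.
apply: eval_cPrepend; last by do 5!apply: eval_cDropS; exact: evFst.
do ?apply: List.Forall2_cons => //; apply: eval_cPrepend; last first.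
  by do 4!apply: eval_cDropS; exact: evFst.
do ?apply: List.Forall2_cons => //; apply: eval_row.
  by do 2!apply: eval_cDropS; exact: evFst.
by do 3!apply: eval_cDropS; exact: evFst.
Qed.

(** * The diagonal argument *)

Definition cNot (f : code) : code := cSub (cConst 1) f.

Lemma eval_cNot f x a : eval f x a -> eval (cNot f) x (1 - a).
Proof. exact/eval_cSub/eval_cConst. Qed.

Definition cGap (f : code) : code :=
  cSub (cComp cFst f) (cMul (cConst 4) (cComp cSnd f)).

Lemma eval_cGap f x a b : eval f x (cpair a b) -> eval (cGap f) x (a - 4 * b).
Proof.
move=> fab; apply: eval_cSub; first by apply: evComp fab _; exact: evFst.
by apply: eval_cMul; [exact: eval_cConst | apply: evComp fab _; exact: evSnd].
Qed.

Lemma eval_cGap_large f x (q : rat) : (6 <= q)%R -> eval f x (enc_rat q) ->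
  exists v, eval (cGap f) x v.+1.
Proof.
move=> q6 /eval_cGap ev; exists (enc_int (numq q) - 4 * enc_int (denq q)).-1.
rewrite prednK ?subn_gt0 //; have d0 := denq_gt0 q.
move: q6; rewrite -{1}(divq_num_den q) ler_pdivlMr ?ltr0z //.
rewrite -[6%R]/(6%:~R)%R -intrM ler_int.
by move: d0; case: (denq q) => // d; case: (numq q) => n /=; lia.
Qed.

Lemma eval_cGap_small f x (q : rat) : (-1 <= q <= 3)%R -> eval f x (enc_rat q) ->
  eval (cGap f) x 0.
Proof.
move=> /andP[ge le] /eval_cGap.
suff /eqP -> : (enc_int (numq q) - 4 * enc_int (denq q) == 0)%N by [].
have d0 := denq_gt0 q; move: ge le; rewrite -{1 2}(divq_num_den q).
rewrite ler_pdivlMr ?ltr0z // ler_pdivrMr ?ltr0z //.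
rewrite -[3%R]/(3%:~R)%R -[(-1)%R]/((-1)%:~R)%R -!intrM !ler_int.
by move: d0; case: (denq q) => // d; case: (numq q) => n /=; lia.
Qed.

Section Diagonal.
Variables (T : Type) (enc : T -> nat) (m : nat) (inst : WA -> T).
Hypothesis enc_inst : forall A, enc (inst A) = cpair (enc_WA A) m.

(* [cMu cFst] halts exactly on [0].  Given its own template as input, the
   program [d] below computes the chain that simulates this very run of [d],
   submits it to [e], and does the opposite of what [e] predicts. *)
Lemma no_halting_test (e : code) :
  ~ (forall M x,
       (halts_on M x -> exists v, eval e (enc (inst (chain M x))) v.+1) /\
       (~ halts_on M x -> eval e (enc (inst (chain M x))) 0)).
Proof.
move=> test; pose d := cComp (cMu cFst) (cComp e (cPair cFill (cConst m))).
pose M := halting_flowchart d.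
have [n [k [t0 [t1 [rows [mats [F fillE]]]]]]] := chain_template M.
pose x := cpair n (cpair k (cpair t0 (cpair t1 (cpair rows (cpair mats F))))).
have ev_inst : eval (cPair cFill (cConst m)) x (enc (inst (chain M x))).
  by rewrite enc_inst fillE; apply: evPair (eval_cConst _ _); exact: eval_cFill.
have [yes no] := test M x; have [halts|nohalt] := pselect (halts_on M x).
  have [v ev] := yes halts; case/halting_flowchartP: halts => y.
  rewrite eval_cCompE => -[z /(is_subset1_eval (evComp ev_inst ev)) <-].
  by rewrite eval_cMuE => -[+ _]; rewrite eval_cFstE.
apply: (nohalt); apply/halting_flowchartP; exists 0.
by apply: evComp (evComp ev_inst (no nohalt)) _; apply: evMu => //; exact: (evFst 0 0).
Qed.

Lemma undecidable_chain (Pr P : T -> Prop) :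
  (forall M x, Pr (inst (chain M x))) ->
  (forall M x, halts_on M x -> ~ P (inst (chain M x))) ->
  (forall M x, ~ halts_on M x -> P (inst (chain M x))) ->
  undecidable enc Pr P.
Proof.
move=> PrP haltsP nohaltP [c dec]; apply: (@no_halting_test (cNot c)) => M x.
have [yes no] := dec _ (PrP M x); split=> [/haltsP /no ev|/nohaltP /yes ev].
  by exists 0; exact: eval_cNot ev.
exact: eval_cNot ev.
Qed.

Lemma unsolvable_chain (Pr : T -> Prop) (Good : T -> rat -> Prop) :
  (forall M x, Pr (inst (chain M x))) ->
  (forall M x q, Good (inst (chain M x)) q -> halts_on M x -> (6 <= q)%R) ->
  (forall M x q, Good (inst (chain M x)) q -> ~ halts_on M x -> (-1 <= q <= 3)%R) ->
  unsolvable enc Pr Good.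
Proof.
move=> PrP large small [c sol]; apply: (@no_halting_test (cGap c)) => M x.
have [q [ev good]] := sol _ (PrP M x); split=> [halts|nohalt].
  exact: eval_cGap_large (large _ _ _ good halts) ev.
exact: eval_cGap_small (small _ _ _ good nohalt) ev.
Qed.

End Diagonal.

(** * The problems *)

Section Problems.
Variable R : realType.
Local Open Scope ring_scope.

Lemma big_O_undecidable (Pr : WA * nat * nat -> Prop) :
  (forall M x, Pr (chain M x, root_index false, root_index true)) ->
  undecidable enc3 Pr (fun x => big_O R x.1.1 x.1.2 x.2).
Proof.
move=> PrP; pose inst A : WA * nat * nat := (A, root_index false, root_index true).
pose m := cpair (root_index false) (root_index true).
apply: (@undecidable_chain _ enc3 m inst) => // M x.
  exact: halting_not_big_O.
exact: diverging_big_O.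
Qed.

Section Distance.
Variable d : WA -> nat -> nat -> \bar R.
Hypothesis tvx_le_d : forall A s s', (tvx R A s s' <= d A s s')%E.
Hypothesis d_le_tvx_sym : forall A s s', (d A s s' <= tvx_sym R A s s')%E.

Let inst (t : rat) A : WA * nat * nat * rat := (A, mix_index false, mix_index true, t).

Lemma enc_inst t A : enc4 (inst t A) =
  cpair (enc_WA A) (cpair (mix_index false) (cpair (mix_index true) (enc_rat t))).
Proof. by []. Qed.

Lemma threshold_undecidable : threshold_problem d.
Proof.
apply: (undecidable_chain (enc_inst 4)) => M x; first exact: dist_bounded_promise.
  move=> /(halting_dist_ge8 tvx_le_d) ge8 /= le4.
  by have := le_trans ge8 le4; rewrite ratr_nat lee_fin ler_nat.
move=> /(diverging_dist_le2 d_le_tvx_sym) le2 /=.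
by apply: le_trans le2 _; rewrite ratr_nat lee_fin ler_nat.
Qed.

Lemma strict_threshold_undecidable : strict_threshold_problem d.
Proof.
apply: (undecidable_chain (enc_inst 4)) => M x; first exact: dist_bounded_promise.
  move=> /(halting_dist_ge8 tvx_le_d) ge8 /= lt4.
  by have := le_lt_trans ge8 lt4; rewrite ratr_nat lte_fin ltr_nat.
move=> /(diverging_dist_le2 d_le_tvx_sym) le2 /=.
by apply: le_lt_trans le2 _; rewrite ratr_nat lte_fin ltr_nat.
Qed.

Lemma additive_unsolvable : additive_approx_task d.
Proof.
apply: (unsolvable_chain (enc_inst 1)) => M x.
  by split; [exact: dist_bounded_promise | exact: ltr01].
  move=> q /=; have [] := fine_dist_gap M x tvx_le_d d_le_tvx_sym; set t := fine _.
  move=> _ + _; rewrite rmorph1 ler_norml => ge8 /andP[_ le] /ge8 t8.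
  by rewrite -(ler_rat R) ratr_nat; lra.
move=> q /=; have [] := fine_dist_gap M x tvx_le_d d_le_tvx_sym; set t := fine _.
move=> t0 _ le2; rewrite rmorph1 ler_norml => /andP[ge le] /le2 t2.
by rewrite -!(ler_rat R) rmorphN rmorph1 ratr_nat; apply/andP; split; lra.
Qed.

Lemma multiplicative_unsolvable : multiplicative_approx_task d.
Proof.
apply: (unsolvable_chain (enc_inst (1 / 4))) => M x.
  by split; [exact: dist_bounded_promise | exact: divr_gt0].
  move=> q /=; have [] := fine_dist_gap M x tvx_le_d d_le_tvx_sym; set t := fine _.
  move=> _ + _; rewrite fmorph_div rmorph1 rmorph_nat => ge8 [ge _] /ge8 t8.
  by rewrite -(ler_rat R) ratr_nat; lra.
move=> q /=; have [] := fine_dist_gap M x tvx_le_d d_le_tvx_sym; set t := fine _.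
move=> t0 _ le2; rewrite fmorph_div rmorph1 rmorph_nat => -[ge le] /le2 t2.
by rewrite -!(ler_rat R) rmorphN rmorph1 ratr_nat; apply/andP; split; lra.
Qed.

End Distance.
End Problems.

Theorem theorem4p2 (R : realType) :
  (* (1) big-O problem: undecidable, even for labelled Markov chains *)
  (bigO_problem_WA R /\ bigO_problem_LMC R) /\
  (* (2) the four threshold problems, under the promise of boundedness *)
  (threshold_problem (@tvx R) /\ strict_threshold_problem (@tvx R) /\
   threshold_problem (@tvx_sym R) /\ strict_threshold_problem (@tvx_sym R)) /\
  (* (3) the four approximation tasks, under the promise of boundedness *)
  (additive_approx_task (@tvx R) /\ multiplicative_approx_task (@tvx R) /\
   additive_approx_task (@tvx_sym R) /\ multiplicative_approx_task (@tvx_sym R)).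
Proof.
have tvx_le_tvx A s s' : (tvx R A s s' <= tvx R A s s')%E by [].
have tvx_le_sym A s s' : (tvx R A s s' <= tvx_sym R A s s')%E.
  by rewrite /tvx_sym le_max lexx.
have sym_le_sym A s s' : (tvx_sym R A s s' <= tvx_sym R A s s')%E by [].
have roots_ok M x : states_ok (chain M x) (root_index false) (root_index true).
  exact: chain_states_ok.
split; [|split].
- split; apply: big_O_undecidable => M x; split => //; first exact: chain_wf.
  exact: chain_LMC.
- split; first exact: threshold_undecidable.
  split; first exact: strict_threshold_undecidable.
  by split; [exact: threshold_undecidable | exact: strict_threshold_undecidable].
- split; first exact: additive_unsolvable.
  split; first exact: multiplicative_unsolvable.
  by split; [exact: additive_unsolvable | exact: multiplicative_unsolvable].
Qed.
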